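(* Let $A\subset \mathbb{F}_q\setminus\{0\}$ with $|A|\ge 2$ and let $L$ be a set of lines in $\mathbb{F}_q^2$. Suppose that \[ |A \cap (cG + d)| \ll \max \big\{|G|^{1/2}, |A|^{51/52}\big\} \] for all proper subfields $G$ of $\mathbb{F}_q$ and all elements $c, d \in \mathbb{F}_q$. Then \[ T(A) \ll |A|^{5-1/104} + q^{-1/95}|A|^{5+1/95}, \] \[ I(A \times A, L) \ll \big(|A|^{173/104} + q^{-1/285}|A|^{476/285}\big) |L|^{2/3} + |L|, \] \[ L(A \times A) \gg \min\{|A|^{2+1/52},\ q^{2/95}|A|^{2-2/95}\}. \]
   Context: $q$ is a power of a prime and $\mathbb{F}_q$ is the finite field with $q$ elements. $T(A)$ is the number of sextuples $(a_1,a_2,a_3,b_1,b_2,b_3)\in A^6$ with $(a_2-a_1)(b_3-b_1)=(a_3-a_1)(b_2-b_1)$. For a finite set of points $P\subset\mathbb{F}_q^2$ and a set of lines $L$ in $\mathbb{F}_q^2$, $I(P,L)=|\{(p,l)\in P\times L: p\in l\}|$. For $P\subset\mathbb{F}_q^2$, $L(P)$ is the number of distinct lines determined by pairs of (distinct) points of $P$ (this is unrelated to the set of lines $L$). $cG+d=\{cg+d: g\in G\}$. $X\ll Y$ (equivalently $Y\gg X$) means $X\le CY$ for an absolute constant $C>0$; the hypothesis is assumed with some fixed absolute constant, uniformly in $G,c,d$, and the implied constants in the conclusions may depend on that constant only. *)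

(* Defs.v *)
From HB Require Import structures.
From mathcomp Require Import all_boot all_order all_algebra.
From mathcomp Require Import reals exp.
Set Implicit Arguments.
Unset Strict Implicit.
Unset Printing Implicit Defensive.
Import Order.TTheory GRing.Theory Num.Theory.
Local Open Scope ring_scope.

(* The field F_q is an arbitrary [F : finFieldType], with q = #|F|; the plane is
   [F * F], and a line is identified with its set of points. *)

Definition proper_subfield (F : finFieldType) (G : {set F}) : Prop :=
  divring_closed (mem G) /\ G \proper [set: F].

Definition affine_image (F : finFieldType) (c d : F) (G : {set F}) : {set F} :=
  [set c * g + d | g in G].

Definition is_line (F : finFieldType) (l : {set F * F}) : bool :=
  [exists u : F, exists v : F, exists w : F,
    ((u, v) != (0, 0)) && (l == [set p | u * p.1 + v * p.2 == w])].

(* This is T(A). *)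
Definition collinear_count (F : finFieldType) (A : {set F}) : nat :=
  #|[set t : F * F * F * F * F * F |
      let: (a1, a2, a3, b1, b2, b3) := t in
      [&& [&& a1 \in A, a2 \in A & a3 \in A],
          [&& b1 \in A, b2 \in A & b3 \in A]
        & (a2 - a1) * (b3 - b1) == (a3 - a1) * (b2 - b1)]]|.

(* This is I(P, L). *)
Definition incidences (F : finFieldType)
    (P : {set F * F}) (L : {set {set F * F}}) : nat :=
  #|[set pl in setX P L | pl.1 \in pl.2]|.

(* This is L(P): the number of lines through at least two distinct points of P. *)
Definition determined_lines (F : finFieldType) (P : {set F * F}) : nat :=
  #|[set l : {set F * F} | is_line l &&
      [exists p in P, exists p' in P, [&& p != p', p \in l & p' \in l]]]|.

(* Main.v *)
Require Import Defs.
From HB Require Import structures.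
From mathcomp Require Import all_boot all_order all_algebra.
From mathcomp Require Import reals exp.
From mathcomp Require Import zify ring lra.
Set Implicit Arguments.
Unset Strict Implicit.
Unset Printing Implicit Defensive.
Import Order.TTheory GRing.Theory Num.Theory.
Local Open Scope ring_scope.

(** The idea is that many collinear triples make [A] resemble a subfield.

    Write [N = #|A|].  A nondegenerate collinear triple of [A x A] consists of
    two triples [(a, x, y)] of [A] with the same ratio
    [xi = (y - a) / (x - a)], so that [T(A)] is, up to [O(N^4)], the sum of
    [Q xi ^ 2], where [Q xi] counts the solutions of [y = (1 - xi) a + xi x] in
    [A] ([collinear_count_le]).  Let [T(A)] be about [delta N^5].  For a popular
    ratio [xi0], a weighted Balog-Szemeredi-Gowers argument ([core_weight],
    [popular_core]) provides subsets [P] and [S] of [A] for which [P - P],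
    [P - xi0 S] and [S - S] have size at most a power of [1 / delta] times [N],
    and such that many other ratios [z] have dense graphs between [S] and [P];
    for these, some translate of [z S] meets [P] in a large set.  Fixing the
    points [a] and [x] makes [y] an affine function of the ratio, which gives
    [B = a + c Z] inside [P], with [Z] a set of such ratios and [#|B|] at least
    a constant times [delta ^ 2 N] ([collinear_structure]).

    The set [R] of quotients [(b1 - b2) / (b3 - b4)] over [B] equals the one
    over [Z].  For [r] in [R], the sum [B + r B] is a combination of four
    dilates [z B] with [z] in [Z], and the triangle inequality exchanges each
    of them for [xi0 P] ([replace_dilate]); hence [B + r B] is small
    ([card_add_quotient]).  If [r] is not in [R] then [#|B + r B| = #|B|^2].
    So if [R] is not closed under [r |-> 1 + r], or under multiplication by
    ratios of elements of [Z], comparing the two estimates bounds [N] by a power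
    of [1 / delta].  If it is closed under both, then [R] is a subfield
    ([quotset_subfield]) and an affine copy of it contains [B]; averaging over
    [r] in [R] yields either the same kind of bound, or a bound on [#|R|]
    ([pivot_trichotomy]).  When [R] is the whole field this bounds [q / N];
    when it is proper the hypothesis on [A] limits [#|B|], and the inequality
    [delta ^ 2 N <= C N ^ (51/52)] is what produces the exponent [1/104]
    ([energy_dichotomy], [collinear_bound]).

    The bounds on incidences and on determined lines follow from the one on
    [T(A)]: the cubes of the numbers of points of [A x A] on distinct lines
    with at least two points sum to at most [2 T(A)] ([sum_line_cubes]), and
    Hölder's inequality ([power_moments]) passes to first and second
    moments. *)

(** * Double counting *)

Lemma sum_fibers (T T' : finType) (f : T -> T') (D : {set T}) (Z : {set T'}) :
  (\sum_(z in Z) #|[set t in D | f t == z]| <= #|D|)%N.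
Proof.
rewrite (eq_bigr (fun z => \sum_(t in D | f t == z) 1)%N); last first.
  by move=> z _; rewrite -sum1_card; apply: eq_bigl => t; rewrite inE.
rewrite (exchange_big_dep (mem D)) /=; last by move=> z t _ /andP[].
rewrite -sum1_card; apply: leq_sum => t tD.
rewrite sum1_card -(card1 (f t)); apply: subset_leq_card.
by apply/subsetP => z; rewrite !inE => /andP[_ /andP[_ /eqP ->]].
Qed.

Lemma card_fibers (R : realDomainType) (T T' : finType) (f : T -> T')
    (D : {set T}) (Z : {set T'}) (m : R) :
  (forall z, z \in Z -> m <= #|[set t in D | f t == z]|%:R) ->
  #|Z|%:R * m <= #|D|%:R.
Proof.
move=> hm; apply: le_trans (_ : (\sum_(z in Z) #|[set t in D | f t == z]|)%:R <= _).
  by rewrite natr_sum mulr_natl -sumr_const; exact: ler_sum.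
by rewrite ler_nat sum_fibers.
Qed.

Lemma weighted_pigeonhole (R : realDomainType) (I : finType) (X : {set I})
    (w m : I -> R) (c : R) :
  X != set0 -> (forall i, i \in X -> 0 < w i) ->
  c * (\sum_(i in X) w i) <= \sum_(i in X) w i * m i ->
  exists2 i, i \in X & c <= m i.
Proof.
case/set0Pn => i0 hi0 w0 h; apply/exists_inP; apply: contraLR h.
rewrite negb_exists_in -ltNge => /forall_inP hc; rewrite mulr_sumr.
rewrite (bigD1 i0) // [ltRHS](bigD1 i0) //=; apply: ltr_leD.
  by rewrite mulrC ltr_pM2r ?w0 // ltNge hc.
apply: ler_sum => i /andP[hi _].
by rewrite mulrC ler_pM2r ?w0 // ltW // ltNge hc.
Qed.

Lemma pigeonhole (T T' : finType) (f : T -> T') (D : {set T}) (Z : {set T'}) :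
  D != set0 -> (forall t, t \in D -> f t \in Z) ->
  exists2 z, z \in Z & (#|D| <= #|Z| * #|[set t in D | f t == z]|)%N.
Proof.
case/set0Pn => t0 ht0 fZ; pose n z : int := (#|Z| * #|[set t in D | f t == z]|)%:R.
have Z0 : Z != set0 by apply/set0Pn; exists (f t0); exact: fZ.
have [] := @weighted_pigeonhole _ _ Z (fun=> 1 : int) n #|D|%:R Z0.
- by [].
- under [leRHS]eq_bigr do rewrite mul1r /n natrM.
  rewrite sumr_const -mulr_sumr mulrC ler_wpM2l // -natr_sum ler_nat.
  rewrite -sum1_card (partition_big f (mem Z)) //=; apply: leq_sum => z _.
  by rewrite -sum1_card; apply/eq_leq/eq_bigl => t; rewrite inE.
by move=> z hz; rewrite ler_nat; exists z.
Qed.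

Lemma card_injectS (T T' : finType) (f : T -> T') (D : {set T}) (E : {set T'}) :
  {in D &, injective f} -> (forall x, x \in D -> f x \in E) ->
  (#|D| <= #|E|)%N.
Proof.
move=> fI fE; rewrite -(card_in_imset fI); apply: subset_leq_card.
by apply/subsetP => _ /imsetP[x xD ->]; exact: fE.
Qed.

(** * Sumsets and the triangle inequality *)

Definition sumset (V : finZmodType) (U W : {set V}) : {set V} :=
  [set u + w | u in U, w in W].
Definition oppset (V : finZmodType) (U : {set V}) : {set V} :=
  [set - u | u in U].

Notation "U :+: W" := (sumset U W) (at level 50, left associativity).
Notation "-: U" := (oppset U) (at level 35, right associativity).

Section Sumsets.
Variable V : finZmodType.
Implicit Types (U W X Y : {set V}) (x y z : V).

Lemma sumsetP U W z :
  reflect (exists u w, [/\ u \in U, w \in W & z = u + w]) (z \in U :+: W).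
Proof.
apply: (iffP imset2P) => [[u w hu hw ->]|[u [w [hu hw ->]]]].
  by exists u, w.
by exists u w.
Qed.

Lemma mem_sumset U W u w : u \in U -> w \in W -> u + w \in U :+: W.
Proof. by move=> hu hw; apply/sumsetP; exists u, w. Qed.

Lemma mem_oppset U u : (u \in -: U) = (- u \in U).
Proof.
apply/imsetP/idP => [[w hw ->]|hu]; first by rewrite opprK.
by exists (- u); rewrite ?opprK.
Qed.

Lemma card_oppset U : #|-: U| = #|U|.
Proof. exact: (card_imset _ oppr_inj). Qed.

Lemma oppsetK U : -: -: U = U.
Proof. by apply/setP => x; rewrite !mem_oppset opprK. Qed.

Lemma sumsetC U W : U :+: W = W :+: U.
Proof.
by apply/setP => z; apply/sumsetP/sumsetP => -[u [w [hu hw ->]]];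
  exists w, u; rewrite addrC.
Qed.

Lemma sumsetA U W X : U :+: (W :+: X) = U :+: W :+: X.
Proof.
apply/setP => z; apply/sumsetP/sumsetP.
  move=> [u [_ [hu /sumsetP[w [x [hw hx ->]]] ->]]].
  by exists (u + w), x; rewrite addrA mem_sumset.
move=> [_ [x [/sumsetP[u [w [hu hw ->]]] hx ->]]].
by exists u, (w + x); rewrite addrA mem_sumset.
Qed.

Lemma sumset0 U : U :+: [set 0] = U.
Proof.
apply/setP => z; apply/sumsetP/idP => [[u [w [hu /set1P -> ->]]]|hz].
  by rewrite addr0.
by exists z, 0; rewrite addr0 set11.
Qed.

Lemma sumset_opp U W : -: (U :+: W) = -: U :+: -: W.
Proof.
apply/setP => z; rewrite mem_oppset; apply/sumsetP/sumsetP.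
  move=> [u [w [hu hw e]]]; exists (- u), (- w).
  by rewrite !mem_oppset !opprK -opprD -e opprK.
move=> [u [w]]; rewrite !mem_oppset => -[hu hw ->].
by exists (- u), (- w); rewrite opprD.
Qed.

Lemma sumsetS U U' W W' :
  U \subset U' -> W \subset W' -> U :+: W \subset U' :+: W'.
Proof. by move=> hU hW; exact: imset2S. Qed.

Lemma oppsetS U W : U \subset W -> -: U \subset -: W.
Proof. exact: imsetS. Qed.

Lemma leq_card_sumset U U' W W' : U \subset U' -> W \subset W' ->
  (#|U :+: W| <= #|U' :+: W'|)%N.
Proof. by move=> hU hW; apply/subset_leq_card/sumsetS. Qed.

Lemma leq_card_sumsetl U W : W != set0 -> (#|U| <= #|U :+: W|)%N.
Proof.
case/set0Pn => w hw; apply: (@card_injectS _ _ (fun u => u + w)).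
  by move=> x y _ _; exact: addIr.
by move=> x hx; exact: mem_sumset.
Qed.

Lemma card_sumset_transl U W t : #|(U :+: [set t]) :+: W| = #|U :+: W|.
Proof.
have -> : U :+: [set t] :+: W = [set x + t | x in U :+: W].
  apply/setP => z; apply/sumsetP/imsetP.
    move=> [_ [w [/sumsetP[u [_ [hu /set1P -> ->]]] hw ->]]].
    by exists (u + w); rewrite ?mem_sumset // addrAC.
  move=> [_ /sumsetP[u [w [hu hw ->]]] ->]; exists (u + t), w.
  by rewrite addrAC mem_sumset ?set11.
exact: (card_imset _ (addIr t)).
Qed.

(** Fix for each sum [z] one representation [z = u + v]; then
    [(z, w) |-> (u - w, w + v)] is injective, because the two components add
    up to [z]. *)
Lemma ruzsa_triangle U W X :
  (#|U :+: X| * #|W| <= #|U :+: -: W| * #|W :+: X|)%N.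
Proof.
pose r z := odflt (0, 0) [pick p : V * V | [&& p.1 \in U, p.2 \in X & z == p.1 + p.2]].
have rP z : z \in U :+: X -> [/\ (r z).1 \in U, (r z).2 \in X & z = (r z).1 + (r z).2].
  case/sumsetP => u [w [hu hw e]]; rewrite /r; case: pickP => [p /and3P[? ? /eqP ?] //|].
  by move/(_ (u, w)); rewrite /= hu hw -e eqxx.
rewrite -!cardsX.
apply: (@card_injectS _ _ (fun p => ((r p.1).1 - p.2, p.2 + (r p.1).2))).
  move=> [z w] [z' w'] /setXP[/= hz hw] /setXP[/= hz' hw'] [e1 e2].
  have [_ _ ez] := rP _ hz; have [_ _ ez'] := rP _ hz'.
  have ezz : z = z'.
    rewrite ez ez' -[(r z).1](subrK w) -addrA e1 e2 addrA subrK.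
    by [].
  move: e2; rewrite ezz => /addIr ->; by [].
move=> [z w] /setXP[/= hz hw]; have [? ? _] := rP _ hz.
by rewrite in_setX /= !mem_sumset // mem_oppset opprK.
Qed.

End Sumsets.

(** * Petridis' lemma and iterated sums *)

Section Petridis.
Variable V : finZmodType.
Implicit Types (A B C P X U W : {set V}).

Lemma sumset_set1U U x C : U :+: (x |: C) = (U :+: C) :|: (U :+: [set x]).
Proof.
apply/setP => z; rewrite in_setU; apply/sumsetP/orP.
  move=> [u [w [hu /setU1P[-> ->|hw ->]]]].
    by right; rewrite mem_sumset ?set11.
  by left; rewrite mem_sumset.
case=> /sumsetP[u [w [hu hw ->]]]; exists u, w; split=> //; apply/setU1P.
  by right.
by left; apply/set1P.
Qed.

Lemma card_sumset1 U x : #|U :+: [set x]| = #|U|.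
Proof. by have := card_sumset_transl U [set 0] x; rewrite !sumset0. Qed.

Lemma petridis_min A B : A != set0 ->
  exists X, [/\ X \subset A, X != set0 &
    forall X', X' \subset A -> (#|X :+: B| * #|X'| <= #|X' :+: B| * #|X|)%N].
Proof.
move=> A0; pose P X := (X \subset A) && (X != set0).
pose f X : rat := #|X :+: B|%:R / #|X|%:R.
have PA : P A by rewrite /P subxx.
case: (arg_minP f PA) => X /andP[XA X0] Xmin.
exists X; split=> // X' X'A.
have [->|X'0] := eqVneq X' set0; first by rewrite cards0 muln0.
have := Xmin X'; rewrite /P X'A X'0 => /(_ isT).
have c0 (Y : {set V}) : Y != set0 -> 0 < #|Y|%:R :> rat by rewrite ltr0n card_gt0.
rewrite /f ler_pdivrMr ?c0 // mulrAC ler_pdivlMr ?c0 //.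
by rewrite -!natrM ler_nat.
Qed.

(** Choose [X] inside [A] with the smallest ratio [#|X + B| / #|X|].  When a
    point [x] is added to [C], the new part of [X + B + C] is a translate of
    [(X + B) \ (X' + B)], where [X'] collects the elements of [X] that bring
    nothing new; minimality bounds [#|X' + B|] from below. *)
Lemma petridis A B : A != set0 ->
  exists X, [/\ X \subset A, X != set0 &
    forall C, (#|X :+: B :+: C| * #|A| <= #|A :+: B| * #|X :+: C|)%N].
Proof.
move=> A0; have [X [XA X0 Xmin]] := petridis_min B A0.
exists X; split=> // C.
suff h : (#|X :+: B :+: C| * #|X| <= #|X :+: B| * #|X :+: C|)%N.
  have X0' : (0 < #|X|)%N by rewrite card_gt0.
  have hA := Xmin A (subxx _).
  rewrite -(leq_pmul2r X0') mulnAC.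
  apply: leq_trans (leq_mul h (leqnn #|A|)) _.
  rewrite mulnAC (mulnAC #|A :+: B|); exact: leq_mul.
rewrite -(set_enum C); elim: (enum C) => [|x s IH].
  have e U : U :+: [set z in [::]] = set0.
    by apply/setP => z; rewrite in_set0; apply/sumsetP => -[u [w []]]; rewrite !inE.
  by rewrite !e cards0.
rewrite set_cons; set D := [set z in s] in IH *.
pose X' := [set a in X | [set a] :+: B :+: [set x] \subset X :+: B :+: D].
have X'X : X' \subset X by apply/subsetP => a; rewrite inE => /andP[].
have hX' := Xmin X' (subset_trans X'X XA).
have h1 : (#|X :+: B :+: (x |: D)| + #|X' :+: B| <= #|X :+: B :+: D| + #|X :+: B|)%N.
  rewrite sumset_set1U cardsU -addnBA ?subset_leq_card ?subsetIr // -addnA leq_add2l.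
  rewrite card_sumset1 -[leqRHS](@subnK #|X' :+: B|) ?leq_card_sumset //.
  rewrite leq_add2r leq_sub2l //.
  rewrite -[leqLHS](card_sumset1 _ x); apply: subset_leq_card.
  rewrite subsetI; apply/andP; split; last by apply: sumsetS => //; exact: sumsetS.
  apply/subsetP => _ /sumsetP[_ [y [/sumsetP[a [b [ha hb ->]]] /set1P -> ->]]].
  move: ha; rewrite inE => /andP[_ /subsetP]; apply.
  by rewrite !mem_sumset ?set11.
have h2 : (#|X :+: D| + #|X| <= #|X :+: (x |: D)| + #|X'|)%N.
  rewrite sumset_set1U cardsU -addnBA ?subset_leq_card ?subsetIr // -addnA leq_add2l.
  suff hI : (#|(X :+: D) :&: (X :+: [set x])| <= #|X'|)%N.
    by rewrite card_sumset1; lia.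
  rewrite -[leqRHS](card_sumset1 _ x); apply: subset_leq_card.
  apply/subsetP => z; rewrite in_setI => /andP[hz /sumsetP[a [y [ha /set1P ey ez]]]].
  rewrite ez ey mem_sumset ?set11 //.
  rewrite inE ha; apply/subsetP => _
    /sumsetP[_ [_ [/sumsetP[_ [b [/set1P -> hb ->]]] /set1P -> ->]]].
  case/sumsetP: hz => [c [d [hc hd ez']]].
  by rewrite addrAC -ey -ez ez' addrAC !mem_sumset.
move: IH h1 h2 hX'.
set a1 := #|X :+: B :+: (x |: D)|; set a2 := #|X' :+: B|.
set a3 := #|X :+: B :+: D|; set k := #|X :+: B|; set n := #|X|.
set b1 := #|X :+: D|; set b2 := #|X :+: (x |: D)|; set m := #|X'|.
nia.
Qed.

(** Petridis' lemma, applied to [P] and [- P], removes one copy of [- P] at a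
    time from [X - P - P - P]; the triangle inequality through [X] then gives
    the mixed sum. *)
Lemma iterated_sumset_bounds P : P != set0 ->
  (#|P :+: P :+: P| * #|P| ^ 2 <= #|P :+: -: P| ^ 3)%N /\
  (#|P :+: P :+: (-: P :+: -: P)| * #|P| ^ 3 <= #|P :+: -: P| ^ 4)%N.
Proof.
move=> P0; have [X [XP X0 hX]] := petridis (-: P) P0.
have hXP := subset_leq_card XP.
have s1 := hX [set 0]; rewrite !sumset0 in s1.
have s2 := hX (-: P).
have s3 := hX (-: P :+: -: P); rewrite !sumsetA in s3.
have n0 : (0 < #|X|)%N by rewrite card_gt0.
have p0 : (0 < #|P|)%N by rewrite card_gt0.
have h3 : (#|P :+: P :+: P| <= #|X :+: -: P :+: -: P :+: -: P|)%N.
  rewrite -(card_oppset (P :+: P :+: P)) !sumset_opp -!sumsetA.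
  by rewrite [(X :+: _)%N]sumsetC leq_card_sumsetl.
have h4 : (#|P :+: P :+: (-: P :+: -: P)| * #|X| <= #|X :+: -: P :+: -: P| ^ 2)%N.
  apply: leq_trans (ruzsa_triangle _ X _) _.
  rewrite sumsetA expnS expn1 leq_mul2r; apply/orP; right.
  by rewrite -(card_oppset (_ :+: -: X)) !sumset_opp oppsetK sumsetC sumsetA.
move: hXP s1 s2 s3 h3 h4 n0 p0.
set n := #|X|; set p := #|P|; set k := #|P :+: -: P|.
set a := #|X :+: -: P|; set b := #|X :+: -: P :+: -: P|.
set c := #|X :+: -: P :+: -: P :+: -: P|.
move=> hnp s1 s2 s3 h3 h4 n0 p0.
have hb : (b * p ^ 2 <= k ^ 2 * n)%N.
  apply: (@leq_trans (k * a * p)); first by nia.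
  by rewrite expnS expn1 -!mulnA leq_mul2l s1 orbT.
split.
  apply: (@leq_trans (c * p ^ 2)); first exact: leq_mul.
  rewrite -(leq_pmul2r p0).
  apply: (@leq_trans (k * (b * p ^ 2))).
    by rewrite mulnAC (mulnA k) leq_mul2r s3 orbT.
  apply: (@leq_trans (k * (k ^ 2 * n))); first by rewrite leq_mul2l hb orbT.
  by rewrite mulnA -expnS leq_mul2l hnp orbT.
rewrite -(leq_pmul2r n0) -(leq_pmul2r p0).
apply: (@leq_trans ((b * p ^ 2) ^ 2)).
  rewrite expnMn -expnM.
  apply: leq_trans (leq_mul h4 (leqnn (p ^ 4))).
  by apply/eq_leq; ring.
apply: (@leq_trans ((k ^ 2 * n) ^ 2)); first by rewrite leq_exp2r.
rewrite expnMn -expnM -mulnA leq_mul2l; apply/orP; right.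
by rewrite expnS expn1 leq_mul2l hnp orbT.
Qed.

End Petridis.

(** * Second moments *)

Lemma sqr_sum_le (R : realDomainType) (I : finType) (P : {set I}) (x : I -> R) :
  (\sum_(i in P) x i) ^+ 2 <= #|P|%:R * \sum_(i in P) x i ^+ 2.
Proof.
have h : 0 <= \sum_(i in P) \sum_(j in P) (x i - x j) ^+ 2.
  by apply: sumr_ge0 => i _; apply: sumr_ge0 => j _; exact: sqr_ge0.
have e : \sum_(i in P) \sum_(j in P) (x i - x j) ^+ 2 =
    (#|P|%:R * \sum_(i in P) x i ^+ 2 - (\sum_(i in P) x i) ^+ 2) *+ 2.
  have ei i : \sum_(j in P) (x i - x j) ^+ 2 =
      #|P|%:R * x i ^+ 2 + ((- 2 * \sum_(j in P) x j) * x i + \sum_(j in P) x j ^+ 2).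
    rewrite (eq_bigr (fun j => x i ^+ 2 + ((- 2 * x i) * x j + x j ^+ 2))).
      by rewrite !big_split /= sumr_const -mulr_natl -mulr_sumr; ring.
    by move=> j _; ring.
  rewrite (eq_bigr _ (fun i _ => ei i)) !big_split /= sumr_const -mulr_natl.
  by rewrite -!mulr_sumr; ring.
move: h; rewrite e; by rewrite pmulrn_lge0 // subr_ge0.
Qed.

Lemma card_collisions (T T' : finType) (f : T -> T') (D : {set T}) :
  (#|D| ^ 2 <= #|f @: D| * #|[set p in setX D D | f p.1 == f p.2]|)%N.
Proof.
pose n z : nat := #|[set t in D | f t == z]|.
have nE z : n z = (\sum_(t in D | f t == z) 1)%N.
  by rewrite /n -sum1_card; apply: eq_bigl => t; rewrite inE.
have e1 : #|D| = (\sum_(z in f @: D) n z)%N.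
  rewrite -sum1_card (partition_big_imset f) /=.
  by apply: eq_bigr => z _; rewrite nE.
have e2 : #|[set p in setX D D | f p.1 == f p.2]| = (\sum_(z in f @: D) n z ^ 2)%N.
  rewrite -sum1_card (partition_big (fun p => f p.1) (mem (f @: D))) /=; last first.
    by move=> p; rewrite !inE => /andP[/andP[h _] _]; exact: imset_f.
  apply: eq_bigr => z _; rewrite /n expnS expn1 -cardsX -sum1_card.
  apply: eq_bigl => p; rewrite !inE.
  case: (f p.1 =P z) => [->|]; rewrite ?andbF ?andbT ?andFb //.
  by rewrite eq_sym andbA.
rewrite -(ler_nat int) natrM natrX e1 e2 !natr_sum.
under [X in _ <= _ * X]eq_bigr => i _ do rewrite natrX.
exact: sqr_sum_le.
Qed.

(** * Dilates and quotient sets *)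

Definition scaleset (F : finFieldType) (c : F) (U : {set F}) : {set F} :=
  [set c * u | u in U].

Notation "c *:: U" := (scaleset c%R U) (at level 40, left associativity).

Section Dilates.
Variable F : finFieldType.
Implicit Types (U W X Z B G : {set F}) (c d r s z : F).

Lemma mem_scaleset c U u : u \in U -> c * u \in c *:: U.
Proof. exact: imset_f. Qed.

Lemma card_scaleset c U : c != 0 -> #|c *:: U| = #|U|.
Proof. by move=> c0; rewrite (card_imset _ (mulfI c0)). Qed.

Lemma scaleset_sum c U W : c *:: (U :+: W) = c *:: U :+: c *:: W.
Proof.
apply/setP => x; apply/imsetP/sumsetP.
  move=> [_ /sumsetP[u [w [hu hw ->]]] ->]; exists (c * u), (c * w).
  by rewrite !mem_scaleset // mulrDr.
move=> [_ [_ [/imsetP[u hu ->] /imsetP[w hw ->] ->]]].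
by exists (u + w); rewrite ?mem_sumset // mulrDr.
Qed.

Lemma scalesetA c d U : c *:: (d *:: U) = (c * d) *:: U.
Proof.
by rewrite /scaleset -imset_comp; apply: eq_imset => u /=; rewrite mulrA.
Qed.

Lemma scaleset1 U : 1 *:: U = U.
Proof. by rewrite /scaleset (eq_imset _ (@mul1r F)) imset_id. Qed.

Lemma scaleset_opp c U : c *:: (-: U) = -: (c *:: U).
Proof.
by rewrite /scaleset /oppset -!imset_comp; apply: eq_imset => u /=; rewrite mulrN.
Qed.

Lemma oppset_scaleset c U : -: (c *:: U) = (- c) *:: U.
Proof.
by rewrite /scaleset /oppset -!imset_comp; apply: eq_imset => u /=; rewrite mulNr.
Qed.

Lemma scalesetS c U W : U \subset W -> c *:: U \subset c *:: W.
Proof. exact: imsetS. Qed.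

Lemma scaleset_set1 c d : c *:: [set d] = [set c * d].
Proof. exact: imset_set1. Qed.

Lemma scaleset_addr c d U : (c + d) *:: U \subset c *:: U :+: d *:: U.
Proof.
by apply/subsetP => _ /imsetP[u hu ->]; rewrite mulrDl mem_sumset ?mem_scaleset.
Qed.

Definition quotset Z : {set F} :=
  [set (t.1.1 - t.1.2) / (t.2.1 - t.2.2) | t in setX (setX Z Z) (setX Z Z)].

Lemma quotsetP Z r :
  reflect (exists z1 z2 z3 z4, [/\ [/\ z1 \in Z, z2 \in Z, z3 \in Z & z4 \in Z]
             & r = (z1 - z2) / (z3 - z4)]) (r \in quotset Z).
Proof.
apply: (iffP imsetP).
  move=> [[[z1 z2] [z3 z4]]] /setXP[/= /setXP[/= ? ?] /setXP[/= ? ?]] ->.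
  by exists z1, z2, z3, z4.
move=> [z1 [z2 [z3 [z4 [[? ? ? ?] ->]]]]]; exists ((z1, z2), (z3, z4)) => //.
by rewrite !in_setX /=; apply/andP; split; apply/andP.
Qed.

(* A vanishing denominator only contributes the quotient [0]. *)
Lemma quotset_den Z r : (1 < #|Z|)%N -> r \in quotset Z ->
  exists z1 z2 z3 z4, [/\ [/\ z1 \in Z, z2 \in Z, z3 \in Z & z4 \in Z],
    z3 != z4 & r = (z1 - z2) / (z3 - z4)].
Proof.
move=> /card_gt1P[x [y [hx hy xy]]] /quotsetP[z1 [z2 [z3 [z4 [[? ? ? ?] ->]]]]].
have [->|z34] := eqVneq z3 z4; last by exists z1, z2, z3, z4.
by exists x, x, x, y; split=> //; rewrite !subrr invr0 mulr0 mul0r.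
Qed.

Lemma quotsetN Z r : r \in quotset Z -> - r \in quotset Z.
Proof.
move=> /quotsetP[z1 [z2 [z3 [z4 [[? ? ? ?] ->]]]]]; apply/quotsetP.
by exists z2, z1, z3, z4; split=> //; rewrite -mulNr opprB.
Qed.

(** A coincidence [b1 + r b2 = b3 + r b4] with [b2 <> b4] would exhibit [r] as
    a quotient of differences. *)
Lemma card_pivot B r : r \notin quotset B -> #|B :+: r *:: B| = (#|B| ^ 2)%N.
Proof.
move=> hr; rewrite expnS expn1 -cardsX.
have -> : B :+: r *:: B = [set p.1 + r * p.2 | p in setX B B].
  apply/setP => x; apply/sumsetP/imsetP.
    by move=> [u [_ [hu /imsetP[w hw ->] ->]]]; exists (u, w); rewrite ?in_setX ?hu.
  move=> [[u w] /setXP[/= hu hw] ->]; exists u, (r * w).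
  by rewrite mem_scaleset.
apply: card_in_imset => -[u w] [u' w'] /setXP[/= hu hw] /setXP[/= hu' hw'] e.
have e' : r * (w - w') = u' - u.
  by apply/eqP; rewrite mulrBr -subr_eq0; apply/eqP; move: e => /eqP; rewrite -subr_eq0 => /eqP <-; ring.
have [ww|nww] := eqVneq w w'.
  by move: e'; rewrite ww subrr mulr0 => /esym/eqP; rewrite subr_eq0 => /eqP ->.
case/negP: hr; apply/quotsetP; exists u', u, w, w'; split=> //.
by rewrite -e' mulfK // subr_eq0.
Qed.

Lemma quotset_affine Z a c : c != 0 ->
  quotset [set a + c * z | z in Z] \subset quotset Z.
Proof.
move=> c0; apply/subsetP => r /quotsetP[b1 [b2 [b3 [b4 [[]]]]]].
move=> /imsetP[z1 h1 ->] /imsetP[z2 h2 ->] /imsetP[z3 h3 ->] /imsetP[z4 h4 ->] ->.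
apply/quotsetP; exists z1, z2, z3, z4; split=> //.
have e x y : (a + c * x) - (a + c * y) = c * (x - y) by ring.
rewrite !e.
by rewrite invfM mulrACA mulfV // mul1r.
Qed.

Lemma finite_onto (T : finType) (f : T -> T) (X : {set T}) :
  injective f -> (forall x, x \in X -> f x \in X) ->
  forall y, y \in X -> exists2 x, x \in X & y = f x.
Proof.
move=> fI fX y hy; apply/imsetP.
have /setP -> // : f @: X = X.
apply/eqP; rewrite eqEcard (card_imset _ fI) leqnn andbT.
by apply/subsetP => _ /imsetP[x hx ->]; exact: fX.
Qed.

(** Let [S] be the multipliers of [R] (those [s] with [s R] inside [R]), [G]
    the translations preserving [R], and [H] the multipliers of [G].  By
    finiteness [S] is stable under inversion, and [r + s = s (s^-1 r + 1)]
    puts [S] inside [G]; hence [G] is preserved by [S], and [H], which is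
    closed under sums, contains the subfield generated by the ratios
    [z / z0].  That subfield contains [R], and [H] is contained in [R]. *)
Lemma quotset_subfield Z z0 : z0 \in Z -> z0 != 0 -> (1 < #|Z|)%N ->
  (forall r, r \in quotset Z -> 1 + r \in quotset Z) ->
  (forall z r, z \in Z -> r \in quotset Z -> z / z0 * r \in quotset Z) ->
  divring_closed (mem (quotset Z)) /\ (forall z, z \in Z -> z / z0 \in quotset Z).
Proof.
move=> Zz0 z00 Z2 hadd hmul; set R := quotset Z in hadd hmul *.
have R0 : 0 \in R.
  by apply/quotsetP; exists z0, z0, z0, z0; rewrite subrr mul0r.
pose S := [set s | [forall r in R, s * r \in R]].
have SP s : reflect (forall r, r \in R -> s * r \in R) (s \in S).
  by rewrite inE; exact: forall_inP.
have Sinv s : s \in S -> s != 0 -> s^-1 \in S.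
  move=> /SP hs s0; apply/SP => r hr.
  have [r' hr' ->] := finite_onto (mulfI s0) hs hr.
  by rewrite mulKf.
have SM s t : s \in S -> t \in S -> s * t \in S.
  by move=> /SP hs /SP ht; apply/SP => r hr; rewrite -mulrA; apply/hs/ht.
have S1 : 1 \in S by apply/SP => r; rewrite mul1r.
have SN1 : -1 \in S by apply/SP => r; rewrite mulN1r; exact: quotsetN.
have SZ z : z \in Z -> z / z0 \in S by move=> hz; apply/SP => r; exact: hmul.
pose G := [set g | [forall r in R, r + g \in R]].
have GP g : reflect (forall r, r \in R -> r + g \in R) (g \in G).
  by rewrite inE; exact: forall_inP.
have SG s : s \in S -> s \in G.
  move=> hs; apply/GP => r hr; have [->|s0] := eqVneq s 0; first by rewrite addr0.
  have -> : r + s = s * (1 + s^-1 * r) by rewrite mulrDr mulr1 mulVKf // addrC.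
  by move/SP: (hs); apply; apply: hadd; move/SP: (Sinv _ hs s0); apply.
have GD g h : g \in G -> h \in G -> g + h \in G.
  by move=> /GP hg /GP hh; apply/GP => r hr; rewrite addrA; apply/hh/hg.
have G0 : 0 \in G by apply/GP => r; rewrite addr0.
have SGM s g : s \in S -> g \in G -> s * g \in G.
  move=> hs /GP hg; have [->|s0] := eqVneq s 0; first by rewrite mul0r.
  apply/GP => r hr.
  have -> : r + s * g = s * (s^-1 * r + g) by rewrite mulrDr mulVKf.
  by move/SP: (hs); apply; apply: hg; move/SP: (Sinv _ hs s0); apply.
pose H := [set h | [forall g in G, h * g \in G]].
have HP h : reflect (forall g, g \in G -> h * g \in G) (h \in H).
  by rewrite inE; exact: forall_inP.
have SH s : s \in S -> s \in H by move=> hs; apply/HP => g; exact: SGM.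
have HD h k : h \in H -> k \in H -> h + k \in H.
  by move=> /HP hh /HP hk; apply/HP => g hg; rewrite mulrDl GD ?hh ?hk.
have HM h k : h \in H -> k \in H -> h * k \in H.
  by move=> /HP hh /HP hk; apply/HP => g hg; rewrite -mulrA hh ?hk.
have HB h k : h \in H -> k \in H -> h - k \in H.
  by move=> hh hk; rewrite -mulN1r HD // HM // SH.
have Hinv h : h \in H -> h^-1 \in H.
  have [->|h0] := eqVneq h 0; first by rewrite invr0.
  move=> /HP hh; apply/HP => g hg.
  have [g' hg' ->] := finite_onto (mulfI h0) hh hg.
  by rewrite mulKf.
have HR h : h \in H -> h \in R.
  by move=> /HP/(_ 1 (SG _ S1)); rewrite mulr1 => /GP/(_ 0 R0); rewrite add0r.
have RH r : r \in R -> r \in H.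
  move=> /quotsetP[z1 [z2 [z3 [z4 [[h1 h2 h3 h4] ->]]]]].
  have -> : (z1 - z2) / (z3 - z4) = (z1 / z0 - z2 / z0) * (z3 / z0 - z4 / z0)^-1.
    by rewrite -!mulrBl invfM invrK mulrACA [z0^-1 * _]mulVf // mulr1.
  by apply: HM; [|apply: Hinv]; apply: HB; apply/SH/SZ.
split; last by move=> z hz; apply/HR/SH/SZ.
split=> [|x y /RH hx /RH hy|x y /RH hx /RH hy].
- exact/HR/SH.
- exact/HR/HB.
- by apply/HR/HM => //; exact: Hinv.
Qed.

(** Averaging over [r] in [G]: a quadruple with [b1 + r b2 = b3 + r b4] is
    either diagonal or determines [r], so some [r] has few collisions. *)
Lemma card_dilate_average G B : G != set0 -> B != set0 ->
  exists2 r, r \in G & (minn (#|B| ^ 2) #|G| <= 2 * #|B :+: r *:: B|)%N.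
Proof.
move=> G0 B0; pose D := setX B B.
pose f r (p : F * F) := p.1 + r * p.2.
pose C r := [set q in setX D D | f r q.1 == f r q.2].
have cD : #|D| = (#|B| ^ 2)%N by rewrite cardsX expnS expn1.
have imE r : f r @: D = B :+: r *:: B.
  apply/setP => x; apply/imsetP/sumsetP.
    move=> [[u w] /setXP[/= hu hw] ->]; exists u, (r * w).
    by rewrite mem_scaleset.
  by move=> [u [_ [hu /imsetP[w hw ->] ->]]]; exists (u, w); rewrite ?in_setX ?hu.
have tot : (\sum_(r in G) #|C r| <= #|G| * #|D| + #|D| ^ 2)%N.
  pose C1 r := [set q in C r | q.1 == q.2]; pose C2 r := [set q in C r | q.1 != q.2].
  have split_C r : #|C r| = (#|C1 r| + #|C2 r|)%N.
    rewrite -(cardsID [set q | q.1 == q.2] (C r)); congr (_ + _)%N; apply: eq_card => q.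
      by rewrite !inE.
    by rewrite !inE andbC.
  rewrite (eq_bigr _ (fun r _ => split_C r)) big_split /=; apply: leq_add.
    rewrite -sum_nat_const; apply: leq_sum => r _.
    apply: (@card_injectS _ _ (fun q => q.1)).
      move=> [q1 q2] [q1' q2'] /=; rewrite !inE /=.
      by move=> /andP[_ /eqP ->] /andP[_ /eqP ->] ->.
    by move=> q; rewrite !inE => /andP[/andP[/andP[]]].
  rewrite (eq_bigr (fun r => \sum_(q in setX D D | q \in C2 r) 1)%N); last first.
    move=> r _; rewrite -sum1_card; apply: eq_bigl => q.
    apply/idP/andP => [h|[_ h] //]; split=> //.
    by move: h; rewrite !inE => /andP[/andP[]].
  rewrite (exchange_big_dep (mem (setX D D))) /=; last by move=> r q _ /andP[].
  rewrite expnS expn1 -cardsX -sum1_card; apply: leq_sum => -[[a b] [c d]] hq.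
  rewrite sum1_card; apply/card_le1_eqP => r r'.
  move=> /andP[/= _ /andP[_ h1]] /andP[/= _ /andP[_ h2]]; move: h1 h2; rewrite !inE /=.
  move=> /andP[/andP[_ /eqP e1] ne] /andP[/andP[_ /eqP e2] _].
  have e : (r - r') * (b - d) = 0.
    transitivity ((f r (a, b) - f r (c, d)) - (f r' (a, b) - f r' (c, d))).
      by rewrite /f /=; ring.
    by rewrite e1 e2 !subrr.
  move/eqP: e; rewrite mulf_eq0 !subr_eq0 => /orP[/eqP //|/eqP bd].
  move: e1 ne; rewrite /f /= bd => /addIr ->.
  by rewrite eqxx.
have [r rG rmin] : exists2 r, r \in G & (#|G| * #|C r| <= #|G| * #|D| + #|D| ^ 2)%N.
  apply/exists_inP; apply: contraLR tot.
  rewrite negb_exists_in -ltnNge => /forall_inP h.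
  have gG : (0 < #|G|)%N by rewrite card_gt0.
  rewrite -(ltn_pmul2l gG) big_distrr /=.
  rewrite -[X in (X < _)%N]sum_nat_const.
  case/set0Pn: G0 => r0 hr0.
  rewrite (bigD1 r0) //= [X in (_ < X)%N](bigD1 r0) //= -addSn.
  apply: leq_add; first by have := h _ hr0; rewrite -ltnNge.
  by apply: leq_sum => r /andP[hr _]; have := h _ hr; rewrite -ltnNge => /ltnW.
exists r => //.
have := card_collisions (f r) D; rewrite imE -/(C r) cD => hc.
move: rmin hc; rewrite cD.
have b0 : (0 < #|B| ^ 2)%N by rewrite expn_gt0 card_gt0 B0.
move: b0; set b := (#|B| ^ 2)%N; set m := #|_ :+: _|; set g := #|G|; set e := #|C r|.
move=> b0 h1 h2.
have h3 : (g * b ^ 2 <= m * (g * b + b ^ 2))%N by nia.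
have h4 : (g * b <= m * (g + b))%N.
  rewrite -(leq_pmul2r b0); move: h3; rewrite !expnS expn0 muln1; nia.
rewrite leqNgt; apply/negP; rewrite leq_min => /andP[h5 h6]; nia.
Qed.

End Dilates.

(** * Expansion by pivoting on the quotient set *)

Section Pivot.
Variable F : finFieldType.
Implicit Types (P S U W X Z B D : {set F}) (a c e r t xi z : F).

Lemma sumsetCA (V : finZmodType) (U W X : {set V}) :
  U :+: (W :+: X) = W :+: (U :+: X).
Proof. by rewrite !sumsetA (sumsetC U). Qed.

Lemma leq_chain4 (d m n x1 x2 x3 x4 x5 : nat) :
  (x1 * d <= m * x2)%N -> (x2 * d <= m * x3)%N -> (x3 * d <= n * x4)%N ->
  (x4 * d <= n * x5)%N -> (x1 * d ^ 4 <= m ^ 2 * n ^ 2 * x5)%N.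
Proof.
move=> s1 s2 s3 s4.
have e1 : (x1 * d ^ 4 = x1 * d * d ^ 3)%N by ring.
have e2 : (m * x2 * d ^ 3 = m * d ^ 2 * (x2 * d))%N by ring.
have e3 : (m * d ^ 2 * (m * x3) = m ^ 2 * d * (x3 * d))%N by ring.
have e4 : (m ^ 2 * d * (n * x4) = m ^ 2 * n * (x4 * d))%N by ring.
have e5 : (m ^ 2 * n * (n * x5) = m ^ 2 * n ^ 2 * x5)%N by ring.
rewrite e1 (leq_trans (leq_mul s1 (leqnn _))) // e2.
rewrite (leq_trans (leq_mul (leqnn _) s2)) // e3.
rewrite (leq_trans (leq_mul (leqnn _) s3)) // e4.
by rewrite (leq_trans (leq_mul (leqnn _) s4)) // e5.
Qed.

Lemma leq_chain3 (d m n k x1 x2 x3 : nat) :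
  (x1 * d <= m * x2)%N -> (x2 * d <= n * x3)%N -> (x3 * d ^ 4 <= k)%N ->
  (x1 * d ^ 6 <= m * n * k)%N.
Proof.
move=> s1 s2 s3.
have e1 : (x1 * d ^ 6 = x1 * d * d ^ 5)%N by ring.
have e2 : (m * x2 * d ^ 5 = m * d ^ 4 * (x2 * d))%N by ring.
have e3 : (m * d ^ 4 * (n * x3) = m * n * (x3 * d ^ 4))%N by ring.
rewrite e1 (leq_trans (leq_mul s1 (leqnn _))) // e2.
rewrite (leq_trans (leq_mul (leqnn _) s2)) // e3.
exact: leq_mul.
Qed.

(** The part [D] of a translate of [xi S] lying in [P] is a bridge: seen in
    [xi S] it is close to [xi U], seen in [P] it is close to a fixed dilate of
    [P].  The triangle inequality through [xi0 D] thus trades the dilate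
    [xi U] for [xi0 P], whatever [xi] is. *)
Lemma replace_dilate P S U W xi0 xi e t : e != 0 -> xi0 != 0 ->
  (#|(e * xi) *:: U :+: W| * #|P :&: (xi *:: S :+: [set t])|
   <= #|U :+: -: (xi0 *:: S)| * #|(e * xi0) *:: P :+: W|)%N.
Proof.
move=> e0 xi00; set D := _ :&: _.
rewrite -(@card_scaleset F (e * xi0) D) ?mulf_neq0 //.
apply: leq_trans (ruzsa_triangle _ _ _) _; apply: leq_mul; last first.
  by apply: leq_card_sumset => //; apply/scalesetS/subsetIl.
have h : (e * xi0) *:: D \subset
    (e * xi) *:: (xi0 *:: S) :+: [set e * xi0 * t].
  have -> : (e * xi) *:: (xi0 *:: S) = (e * xi0) *:: (xi *:: S).
    by rewrite !scalesetA; congr (_ *:: _); ring.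
  by rewrite -scaleset_set1 -scaleset_sum; apply/scalesetS/subsetIr.
apply: leq_trans (leq_card_sumset (subxx _) (oppsetS h)) _.
rewrite sumset_opp sumsetA -scaleset_opp -scaleset_sum.
rewrite [-: [set _]](_ : _ = [set - (e * xi0 * t)]); last exact: imset_set1.
rewrite card_sumset1 /scaleset; exact: leq_imset_card.
Qed.

Section Expansion.
Variables (P S Z : {set F}) (xi0 : F) (d : nat).
Hypothesis xi00 : xi0 != 0.
Hypothesis bridge : forall z, z \in Z ->
  exists t, (d <= #|P :&: (z *:: S :+: [set t])|)%N.
Hypothesis Z2 : (1 < #|Z|)%N.

Let n U := #|U :+: -: (xi0 *:: S)|.
Let PP := #|P :+: P :+: (-: P :+: -: P)|.

Lemma replace_dilate_le U W z e : z \in Z -> e != 0 ->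
  (#|(e * z) *:: U :+: W| * d <= n U * #|(e * xi0) *:: P :+: W|)%N.
Proof.
move=> /bridge[t ht] e0; apply: leq_trans (replace_dilate P S U W z t e0 xi00).
by rewrite leq_mul2l ht orbT.
Qed.

(** After clearing the denominator of [r = (z1 - z2) / (z3 - z4)], four dilates
    by elements of [Z] appear; each is replaced by [xi0 P] or [- xi0 P]. *)
Lemma card_add_quotient U U' r : r \in quotset Z ->
  (#|U :+: r *:: U'| * d ^ 4 <= n U ^ 2 * n U' ^ 2 * PP)%N.
Proof.
case/(quotset_den Z2) => z1 [z2 [z3 [z4 [[h1 h2 h3 h4] z34 ->]]]].
have w0 : z3 - z4 != 0 by rewrite subr_eq0.
pose W1 := (-1 * z4) *:: U; pose W2 := (1 * z1) *:: U'.
pose W3 := (-1 * z2) *:: U'; pose W0 := (1 * z3) *:: U.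
have N1 : -1 != 0 :> F by rewrite oppr_eq0 oner_eq0.
have le1 : (#|U :+: ((z1 - z2) / (z3 - z4)) *:: U'|
            <= #|W0 :+: (W1 :+: (W2 :+: W3))|)%N.
  rewrite -(card_scaleset _ w0) scaleset_sum scalesetA.
  rewrite mulrC divfK // sumsetA; apply: leq_card_sumset.
    by rewrite /W0 /W1 mul1r mulN1r scaleset_addr.
  by rewrite /W2 /W3 mul1r mulN1r scaleset_addr.
pose p := (1 * xi0) *:: P; pose p' := (-1 * xi0) *:: P.
have s1 := replace_dilate_le U (W1 :+: (W2 :+: W3)) h3 (oner_neq0 F).
have s2 := replace_dilate_le U (p :+: (W2 :+: W3)) h4 N1.
have s3 := replace_dilate_le U' (p' :+: (p :+: W3)) h1 (oner_neq0 F).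
have s4 := replace_dilate_le U' (p :+: (p' :+: p)) h2 N1.
rewrite -/W0 -/W1 -/W2 -/W3 -/p -/p' in s1 s2 s3 s4.
rewrite (sumsetCA p W1) (sumsetCA p W2) (sumsetC p W3) in s1.
rewrite (sumsetCA p W2) (sumsetCA p' W2) (sumsetC p W3) (sumsetCA p' W3) in s2.
rewrite (sumsetC p W3) (sumsetCA p' W3) (sumsetCA p W3) in s3.
have e5 : #|p' :+: (p :+: (p' :+: p))| = PP.
  rewrite /p /p' mul1r mulN1r /PP -[RHS](@card_scaleset F xi0) // !scaleset_sum.
  rewrite !scaleset_opp !oppset_scaleset.
  set Q := xi0 *:: P; set Q' := (- xi0) *:: P.
  by rewrite (sumsetC Q' Q) 2!(sumsetCA Q' Q) !sumsetA.
rewrite e5 in s4.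
apply: leq_trans (leq_mul le1 (leqnn _)) _.
exact: leq_chain4 s1 s2 s3 s4.
Qed.

Section Pivot_on_B.
Variables (B : {set F}) (a c : F).
Hypothesis c0 : c != 0.
Hypothesis BZ : B = [set a + c * z | z in Z].
Hypothesis BP : B \subset P.
Hypothesis Z0 : 0 \notin Z.

Let p := #|P :+: -: P|.
Let u := n P.
Let s := #|S :+: -: S|.

Let nB : (n B <= u)%N. Proof. exact: leq_card_sumset. Qed.

Let nS : n (xi0 *:: S) = s.
Proof. by rewrite /n -scaleset_opp -scaleset_sum card_scaleset. Qed.

Let card_pivotZ r : r \notin quotset Z -> #|B :+: r *:: B| = (#|B| ^ 2)%N.
Proof.
move=> hr; apply: card_pivot; apply: contra hr; rewrite BZ.
exact/subsetP/quotset_affine.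
Qed.

(** [R] contains [r] but not [1 + r]: expand [B + (1 + r) B] inside
    [B + B + r B]. *)
Lemma pivot_add r : r \in quotset Z -> 1 + r \notin quotset Z ->
  (#|B| ^ 2 * #|P| * d ^ 4 <= #|P :+: P :+: P| * (u ^ 4 * PP))%N.
Proof.
move=> hr /card_pivotZ <-.
have h1 : (#|B :+: (1 + r) *:: B| <= #|B :+: B :+: r *:: B|)%N.
  rewrite -sumsetA; apply: leq_card_sumset => //.
  by rewrite -{2}(scaleset1 B) scaleset_addr.
have h2 := ruzsa_triangle (B :+: B) (-: P) (r *:: B).
rewrite oppsetK card_oppset in h2.
have h3 : (#|B :+: B :+: P| <= #|P :+: P :+: P|)%N.
  by do 2?apply: leq_card_sumset => //; exact: sumsetS.
have h4 := card_add_quotient P B (quotsetN hr).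
have h5 : #|P :+: (- r) *:: B| = #|-: P :+: r *:: B|.
  by rewrite -card_oppset sumset_opp oppset_scaleset opprK.
rewrite h5 in h4.
apply: (@leq_trans (#|P :+: P :+: P| * #|-: P :+: r *:: B| * d ^ 4)).
  rewrite leq_mul2r; apply/orP; right.
  apply: leq_trans (leq_mul h1 (leqnn _)) _; apply: leq_trans h2 _.
  exact: leq_mul.
rewrite -mulnA leq_mul2l; apply/orP; right; apply: leq_trans h4 _.
rewrite leq_mul2r -[4%N]/(2 + 2)%N expnD leq_mul2l leq_exp2r //.
by rewrite nB !orbT.
Qed.

(** [R] contains [r] but not [(z / z0) r]: here [z0 B] and [z B] are compared
    through [xi0 P]. *)
Lemma pivot_mul z0 z r : z0 \in Z -> z \in Z -> r \in quotset Z ->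
  z / z0 * r \notin quotset Z ->
  (#|B| ^ 2 * d ^ 6 <= u * p * (s ^ 2 * u ^ 2 * PP))%N.
Proof.
move=> hz0 hz hr /card_pivotZ <-.
have z00 : z0 != 0 by apply: contraNneq Z0 => <-.
have zn0 : z != 0 by apply: contraNneq Z0 => <-.
have h1 : #|B :+: (z / z0 * r) *:: B| = #|(1 * z0) *:: B :+: (z * r) *:: B|.
  rewrite -(card_scaleset _ z00) scaleset_sum scalesetA mul1r.
  by rewrite (_ : z0 * (z / z0 * r) = z * r) //; field.
have h2 := replace_dilate_le B ((z * r) *:: B) hz0 (oner_neq0 F).
have [t ht] := bridge hz; set D := _ :&: _ in ht.
have h3 := ruzsa_triangle (xi0 *:: P) (xi0 *:: D) ((z * r) *:: B).
rewrite card_scaleset // in h3.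
have h4 : (#|xi0 *:: P :+: -: (xi0 *:: D)| <= p)%N.
  rewrite -scaleset_opp -scaleset_sum card_scaleset //.
  by apply: leq_card_sumset => //; apply/oppsetS/subsetIl.
have h5 : (#|xi0 *:: D :+: (z * r) *:: B| <= #|xi0 *:: S :+: r *:: B|)%N.
  apply: (@leq_trans #|z *:: (xi0 *:: S) :+: [set xi0 * t] :+: (z * r) *:: B|).
    apply: leq_card_sumset => //.
    by rewrite scalesetA mulrC -scalesetA -scaleset_set1 -scaleset_sum;
      apply/scalesetS/subsetIr.
  by rewrite card_sumset_transl -scalesetA -scaleset_sum card_scaleset.
have h6 := card_add_quotient (xi0 *:: S) B hr.
rewrite nS in h6; rewrite h1; move: h2; rewrite (mul1r xi0) => h2.
have h7 := leq_trans (leq_mul (leqnn _) ht) (leq_trans h3 (leq_mul h4 h5)).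
have h8 := leq_trans h2 (leq_mul nB (leqnn _)).
have h9 := leq_trans h6 (leq_mul (leq_mul (leqnn (s ^ 2))
  (leq_mul nB nB : (n B ^ 2 <= u ^ 2)%N)) (leqnn PP)).
exact: leq_chain3 h8 h7 h9.
Qed.

Lemma pivot_subfield : B != set0 -> divring_closed (mem (quotset Z)) ->
  (minn (#|B| ^ 2) #|quotset Z| * d ^ 4 <= 2 * (u ^ 4 * PP))%N.
Proof.
move=> B0 [R1 _ _].
have [|r rR hr] := @card_dilate_average F (quotset Z) B _ B0.
  by apply/set0Pn; exists 1.
apply: leq_trans (leq_mul hr (leqnn _)) _; rewrite -mulnA leq_mul2l /=.
apply: leq_trans (card_add_quotient B B rR) _.
by rewrite leq_mul2r -[4%N]/(2 + 2)%N expnD leq_mul ?leq_exp2r ?orbT.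
Qed.

(** The three ways in which a set of quotients can behave: not closed under
    adding [1], not closed under multiplication by ratios of [Z], or a
    subfield, one affine copy of which contains [B]. *)
Lemma pivot_trichotomy :
  [\/ (#|B| ^ 2 * #|P| * d ^ 4 <= #|P :+: P :+: P| * (u ^ 4 * PP))%N,
      (#|B| ^ 2 * d ^ 6 <= u * p * (s ^ 2 * u ^ 2 * PP))%N
    | exists G : {set F}, exists b : F, exists a' : F,
      [/\ divring_closed (mem G), B \subset affine_image b a' G
        & (minn (#|B| ^ 2) #|G| * d ^ 4 <= 2 * (u ^ 4 * PP))%N]].
Proof.
have /card_gt0P[z0 hz0] : (0 < #|Z|)%N by apply: ltn_trans Z2.
have z00 : z0 != 0 by apply: contraNneq Z0 => <-.
have [/forall_inP hadd|] := boolP [forall r in quotset Z, 1 + r \in quotset Z];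
  last first.
  by case/forall_inPn => r hr hr'; constructor 1; exact: pivot_add hr hr'.
have [/forall_inP hmul|] := boolP
  [forall z in Z, [forall r in quotset Z, z / z0 * r \in quotset Z]]; last first.
  case/forall_inPn => z hz /forall_inPn[r hr hr']; constructor 2.
  exact: pivot_mul hz0 hz hr hr'.
have hmul' z r : z \in Z -> r \in quotset Z -> z / z0 * r \in quotset Z.
  by move=> /hmul/forall_inP; apply.
have [hR hZ] := quotset_subfield hz0 z00 Z2 hadd hmul'.
constructor 3; exists (quotset Z), (c * z0), a; split=> //.
  rewrite BZ; apply/subsetP => _ /imsetP[z hz ->]; apply/imsetP.
  by exists (z / z0); [exact: hZ|field].
apply: pivot_subfield => //.
by rewrite BZ; apply/set0Pn; exists (a + c * z0); exact: imset_f.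
Qed.

End Pivot_on_B.
End Expansion.
End Pivot.

(** * Structured neighbourhoods in bipartite graphs *)

Section Bipartite.
Variables (R : realFieldType) (T1 T2 : finType).
Implicit Types (E : {set T1 * T2}) (h N : R).

Definition rnbr E (y : T1) : {set T2} := [set x | (y, x) \in E].
Definition lnbr E (x : T2) : {set T1} := [set y | (y, x) \in E].
Definition mindeg E h : Prop := forall y x, (y, x) \in E ->
  h <= #|rnbr E y|%:R /\ h <= #|lnbr E x|%:R.

Lemma card_rnbr E y : #|rnbr E y| = #|[set e in E | e.1 == y]|.
Proof.
rewrite -(card_imset _ (fun x x' (e : (y, x) = (y, x')) => congr1 snd e)).
apply: eq_card => -[y' x]; rewrite inE /=; apply/imsetP/andP.
  by move=> [x' hx' [-> ->]]; move: hx'; rewrite inE.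
by move=> [hE /eqP e]; exists x; rewrite ?inE -?e.
Qed.

Lemma card_lnbr E x : #|lnbr E x| = #|[set e in E | e.2 == x]|.
Proof.
rewrite -(card_imset _ (fun y y' (e : (y, x) = (y', x)) => congr1 fst e)).
apply: eq_card => -[y x']; rewrite inE /=; apply/imsetP/andP.
  by move=> [y' hy' [-> ->]]; move: hy'; rewrite inE.
by move=> [hE /eqP e]; exists y; rewrite ?inE -?e.
Qed.

(** A subgraph maximizing the number of edges minus [h] times the number of
    vertices has minimum degree at least [h]: otherwise dropping a vertex would
    increase that quantity. *)
Lemma mindeg_subgraph E h : 0 <= h ->
  exists E', [/\ E' \subset E, mindeg E' h &
    #|E|%:R - h * (#|[set e.1 | e in E]|%:R + #|[set e.2 | e in E]|%:R)
      <= #|E'|%:R].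
Proof.
move=> h0; pose f (E' : {set T1 * T2}) : R :=
  #|E'|%:R - h * (#|[set e.1 | e in E']|%:R + #|[set e.2 | e in E']|%:R).
case: (@arg_maxP _ _ _ E (fun E' => E' \subset E) f (subxx E)) => E' sE' max.
exists E'; split=> //; last first.
  apply: le_trans (max E (subxx _)) _; rewrite lerBlDr lerDl.
  by rewrite mulr_ge0 ?addr_ge0.
have drop (D : {set T1 * T2}) : D \subset E' ->
    h * ((#|[set e.1 | e in E']|%:R - #|[set e.1 | e in E' :\: D]|%:R)
       + (#|[set e.2 | e in E']|%:R - #|[set e.2 | e in E' :\: D]|%:R)) <= #|D|%:R.
  move=> DE; have /max : E' :\: D \subset E by apply: subset_trans sE'; exact: subsetDl.
  rewrite /f cardsD (setIidPr DE) natrB ?subset_leq_card //= => hm; lra.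
have sub1 (D : {set T1 * T2}) : (#|[set e.1 | e in E' :\: D]| <= #|[set e.1 | e in E']|)%N.
  by apply/subset_leq_card/imsetS/subsetDl.
have sub2 (D : {set T1 * T2}) : (#|[set e.2 | e in E' :\: D]| <= #|[set e.2 | e in E']|)%N.
  by apply/subset_leq_card/imsetS/subsetDl.
move=> y x yxE; split.
  rewrite card_rnbr; set D := [set e in E' | _].
  have DE : D \subset E' by apply/subsetP => e; rewrite inE => /andP[].
  apply: le_trans (drop _ DE); rewrite -[leLHS]mulr1 ler_wpM2l //.
  have : (#|[set e.1 | e in E' :\: D]| < #|[set e.1 | e in E']|)%N.
    apply: proper_card; rewrite properEneq imsetS ?subsetDl // andbT.
    apply: contraTneq (imset_f fst yxE) => <- /=.
    by apply/imsetP => -[e]; rewrite !inE negb_and => /andP[/orP[/negPf->|/eqP]] // ne _ /esym.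
  rewrite -addn1 -(ler_nat R) natrD; have := sub2 D; rewrite -(ler_nat R); lra.
rewrite card_lnbr; set D := [set e in E' | _].
have DE : D \subset E' by apply/subsetP => e; rewrite inE => /andP[].
apply: le_trans (drop _ DE); rewrite -[leLHS]mulr1 ler_wpM2l //.
have : (#|[set e.2 | e in E' :\: D]| < #|[set e.2 | e in E']|)%N.
  apply: proper_card; rewrite properEneq imsetS ?subsetDl // andbT.
  apply: contraTneq (imset_f snd yxE) => <- /=.
  by apply/imsetP => -[e]; rewrite !inE negb_and => /andP[/orP[/negPf->|/eqP]] // ne _ /esym.
rewrite -addn1 -(ler_nat R) natrD; have := sub1 D; rewrite -(ler_nat R); lra.
Qed.

Definition codeg E y y' : nat := #|rnbr E y :&: rnbr E y'|.

Definition bad_nbrs E (eta : R) v y : {set T1} :=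
  [set y' in lnbr E v | (codeg E y y')%:R < eta].

(** The Balog-Szemeredi-Gowers neighbourhood of [v], pruned of the vertices
    that have small codegree with too many other neighbours of [v]. *)
Definition core E h (eta : R) v : {set T1} :=
  [set y in lnbr E v | (#|bad_nbrs E eta v y|%:R : R) <= h / 4].

Lemma sum_bad_nbrs E (eta : R) y (W1 : {set T1}) :
  (forall e, e \in E -> e.1 \in W1) -> 0 <= eta ->
  \sum_(v in rnbr E y) #|bad_nbrs E eta v y|%:R <= #|W1|%:R * eta.
Proof.
move=> EW1 eta0.
rewrite (eq_bigr (fun v => \sum_(y' in W1 | y' \in bad_nbrs E eta v y) 1 : R)); last first.
  move=> v _; rewrite -sum1_card natr_sum; apply: eq_bigl => y'.
  rewrite !inE andbC; case: (boolP ((y', v) \in E)) => [/EW1 -> //|_].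
  by rewrite !andbF.
rewrite (exchange_big_dep (mem W1)) /=; last by move=> v y' _ /andP[].
rewrite mulr_natl -sumr_const; apply: ler_sum => y' hy'.
have [hlt|hge] := ltP (codeg E y y')%:R eta.
  apply: le_trans (ltW hlt); rewrite /codeg -sum1_card natr_sum.
  rewrite le_eqVlt; apply/orP; left; apply/eqP; apply: eq_bigl => v.
  by rewrite !inE hy' hlt andbT.
rewrite big_pred0 // => v.
by rewrite !inE ltNge hge andbF !andbF.
Qed.

(** A random vertex [v] has, on average, weighted degree at least [h] times the
    total weight.  A pair [y, y'] of small codegree is caught by few [v], so the
    elements with more than [h / 4] such partners inside the neighbourhood of
    [v] carry at most half of that weight.  Weighing the bad pairs by [w y]
    rather than counting them avoids any loss when [w] is unevenly spread. *)
Lemma core_weight E h N (W1 : {set T1}) (W2 : {set T2}) (w : T1 -> R) :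
  0 < h -> 0 < N -> mindeg E h ->
  (forall e, e \in E -> e.1 \in W1 /\ e.2 \in W2) -> #|W1|%:R <= N ->
  (forall y, 0 <= w y) ->
  h / 2 * \sum_(y in W1 | rnbr E y != set0) w y
    <= \sum_(v in W2) \sum_(y in core E h (h ^+ 2 / (8 * N)) v) w y.
Proof.
move=> h0 N0 Eh EW W1N w0; set eta := h ^+ 2 / (8 * N).
have eta0 : 0 <= eta by rewrite divr_ge0 ?sqr_ge0 // ltW // mulr_gt0.
pose b v y : R := #|bad_nbrs E eta v y|%:R.
have step1 : \sum_(v in W2) \sum_(y in lnbr E v) w y * (1 - 4 / h * b v y)
    <= \sum_(v in W2) \sum_(y in core E h eta v) w y.
  apply: ler_sum => v _.
  rewrite (big_setID (core E h eta v)) /=.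
  rewrite (setIidPr _); last by apply/subsetP => y; rewrite inE => /andP[].
  rewrite -[leRHS]addr0; apply: lerD.
    apply: ler_sum => y _; rewrite ler_piMr // lerBlDr lerDl mulr_ge0 //.
    by rewrite divr_ge0 // ltW.
  apply: sumr_le0 => y; rewrite !inE => /andP[+ hy]; rewrite hy /= -ltNge => hb.
  rewrite mulr_ge0_le0 // subr_le0 mulrAC ler_pdivlMr // mul1r.
  by rewrite -/(b v y) in hb; lra.
apply: le_trans step1.
rewrite (eq_bigr (fun v => \sum_(y in W1 | (y, v) \in E) w y * (1 - 4 / h * b v y))); last first.
  move=> v _; apply: eq_bigl => y; rewrite inE.
  by case: (boolP ((y, v) \in E)) => [/EW[/= -> _]|]; rewrite ?andbF.
rewrite (exchange_big_dep (mem W1)) /=; last by move=> v y _ /andP[].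
rewrite big_mkcondr mulr_sumr /=; apply: ler_sum => y hy.
rewrite (eq_bigl (mem (rnbr E y))); last first.
  by move=> v; rewrite hy !inE /=; case: (boolP ((y, v) \in E)) => [/EW[_ /= ->]|]; rewrite ?andbF.
have [->|/set0Pn[x]] := eqVneq (rnbr E y) set0; first by rewrite /= big_set0 mulr0.
rewrite inE => /Eh[hd _].
rewrite /= -mulr_sumr big_split /= sumr_const sumrN -mulr_sumr mulrC ler_wpM2l //.
have := @sum_bad_nbrs E eta y W1 (fun e he => (EW e he).1) eta0.
rewrite -/(b _ y); set sb := \sum_(_ in _) _ => hs.
have hs' : sb <= h ^+ 2 / 8.
  apply: le_trans hs _; apply: le_trans (ler_wpM2r eta0 W1N) _.
  by rewrite /eta le_eqVlt; apply/orP; left; apply/eqP; field; lra.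
have : 4 / h * sb <= h / 2.
  rewrite mulrAC ler_pdivrMr // mulrAC ler_pdivlMr //; rewrite expr2 in hs'; lra.
by lra.
Qed.

(** Two elements of a core share at least half a neighbourhood of good
    partners, which is what makes differences inside the core popular. *)
Lemma core_common E h (eta : R) v y y' : mindeg E h ->
  y \in core E h eta v -> y' \in core E h eta v ->
  h / 2 <= #|[set z in lnbr E v | (eta <= (codeg E y z)%:R) &&
                                  (eta <= (codeg E y' z)%:R)]|%:R.
Proof.
move=> Eh; rewrite !inE => /andP[hv hy] /andP[_ hy'].
have [_ hd] := Eh _ _ hv.
set G := [set z in _ | _].
have : (#|lnbr E v| <= #|G| + (#|bad_nbrs E eta v y| + #|bad_nbrs E eta v y'|))%N.
  have sub : lnbr E v \subset G :|: (bad_nbrs E eta v y :|: bad_nbrs E eta v y').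
    apply/subsetP => z hz; rewrite !inE in hz *; rewrite hz /= !ltNge.
    by case: (eta <= _); case: (eta <= _).
  apply: leq_trans (subset_leq_card sub) _.
  apply: leq_trans (leq_card_setU _ _) _; rewrite leq_add2l.
  exact: leq_card_setU.
rewrite -(ler_nat R) !natrD; lra.
Qed.

End Bipartite.

(** * The graphs of a ratio *)

Section Structure.
Variables (R : realFieldType) (F : finFieldType) (A : {set F}).
Implicit Types (xi a x y v z : F) (Xi : {set F}).

Local Notation N := (#|A|%:R : R).

(** The point dividing the segment from [x] to [y] so that
    [y - apex = xi (x - apex)]. *)
Definition apex xi y x : F := (y - xi * x) / (1 - xi).

(** The pairs [(y, x)] that complete to a triple of [A] of ratio [xi]; diagonal
    pairs, which would belong to every ratio, are left out. *)
Definition ratio_edges xi : {set F * F} :=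
  [set p | [&& p.1 \in A, p.2 \in A, p.1 != p.2 & apex xi p.1 p.2 \in A]].

Lemma apexE xi y x : xi != 1 -> y = (1 - xi) * apex xi y x + xi * x.
Proof.
move=> xi1; rewrite /apex mulrC divfK ?subrK //.
by rewrite subr_eq0 eq_sym.
Qed.

Lemma apex_inj xi xi' y x : y != x -> xi != 1 -> xi' != 1 ->
  apex xi y x = apex xi' y x -> xi = xi'.
Proof.
move=> yx xi1 xi'1 e; set a := apex xi y x in e.
have e1 : y - a = xi * (x - a) by rewrite {1}(apexE y x xi1) -/a; ring.
have e2 : y - a = xi' * (x - a) by rewrite {1}(apexE y x xi'1) -e; ring.
have xa : x - a != 0.
  apply: contraNneq yx => xa0; move: e1; rewrite xa0 mulr0 => /eqP.
  rewrite subr_eq0 => /eqP ->; move/eqP: xa0; rewrite subr_eq0 => /eqP ->.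
  by [].
by apply: (mulIf xa); rewrite -e1 -e2.
Qed.

Lemma ratio_edgesP xi p : p \in ratio_edges xi ->
  [/\ p.1 \in A, p.2 \in A, p.1 != p.2 & apex xi p.1 p.2 \in A].
Proof. by rewrite inE => /and4P[]. Qed.

(** The apex of a given pair determines the ratio. *)
Lemma card_colours Xi p : 1 \notin Xi ->
  (#|[set xi in Xi | p \in ratio_edges xi]| <= #|A|)%N.
Proof.
move=> Xi1; have n1 xi : xi \in Xi -> xi != 1 by apply: contraTneq => ->.
apply: (@card_injectS _ _ (fun xi => apex xi p.1 p.2)).
  move=> xi xi'; rewrite inE => /andP[/n1 h1 /ratio_edgesP[_ _ h _]].
  by rewrite inE => /andP[/n1 h2 _]; exact: apex_inj.
by move=> xi; rewrite inE => /andP[_ /ratio_edgesP[]].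
Qed.

Lemma exchange_colours (Xi : {set F}) (E : F -> {set F * F}) (D : {set F * F}) :
  (\sum_(xi in Xi) #|E xi :&: D| = \sum_(p in D) #|[set xi in Xi | p \in E xi]|)%N.
Proof.
rewrite (eq_bigr (fun xi => \sum_(p in D | p \in E xi) 1)%N); last first.
  by move=> xi _; rewrite -sum1_card; apply: eq_bigl => p; rewrite inE andbC.
rewrite (exchange_big_dep (mem D)) /=; last by move=> xi p _ /andP[].
apply: eq_bigr => p hp; rewrite -sum1_card; apply: eq_bigl => xi.
by rewrite inE hp.
Qed.

Lemma ratio_edges_sub xi : ratio_edges xi \subset setX A A.
Proof. by apply/subsetP => p /ratio_edgesP[h1 h2 _ _]; rewrite inE h1. Qed.

Lemma sum_ratio_edges Xi : 1 \notin Xi ->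
  (\sum_(xi in Xi) #|ratio_edges xi| <= #|A| ^ 3)%N.
Proof.
move=> Xi1.
rewrite (eq_bigr (fun xi => #|ratio_edges xi :&: setX A A|)); last first.
  by move=> xi _; rewrite (setIidPl (ratio_edges_sub xi)).
rewrite exchange_colours.
apply: (@leq_trans (\sum_(p in setX A A) #|A|)%N).
  by apply: leq_sum => p _; exact: card_colours.
by rewrite sum_nat_const cardsX !expnS expn0 muln1 mulnA.
Qed.

(** Cauchy-Schwarz in two ways: over the points [p], and over the pairs of
    indices whose sets contain [p]. *)
Lemma weighted_overlap (I T : finType) (X : {set I}) (D : {set T})
    (E : I -> {set T}) (q : I -> R) :
  (forall i, E i \subset D) ->
  (\sum_(i in X) q i * #|E i|%:R) ^+ 2 <=
  #|D|%:R * \sum_(i in X) q i ^+ 2 * \sum_(p in E i) #|[set j in X | p \in E j]|%:R.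
Proof.
move=> ED; pose W p := \sum_(i in [set j in X | p \in E j]) q i.
have -> : \sum_(i in X) q i * #|E i|%:R = \sum_(p in D) W p.
  rewrite /W (eq_bigr (fun i => \sum_(p in D | p \in E i) q i)); last first.
    move=> i _; rewrite mulr_natr -sumr_const; apply: eq_bigl => p.
    by case: (boolP (p \in E i)) => [/(subsetP (ED i)) -> //|]; rewrite andbF.
  rewrite (exchange_big_dep (mem D)) /=; last by move=> i p _ /andP[].
  apply: eq_bigr => p hp; apply: eq_bigl => i; by rewrite inE hp.
apply: le_trans (sqr_sum_le _ _) _; apply: ler_wpM2l => //.
have -> : \sum_(i in X) q i ^+ 2 * \sum_(p in E i) #|[set j in X | p \in E j]|%:R =
    \sum_(p in D) #|[set j in X | p \in E j]|%:R * \sum_(i in [set j in X | p \in E j]) q i ^+ 2.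
  rewrite (eq_bigr (fun i => \sum_(p in D | p \in E i)
     #|[set j in X | p \in E j]|%:R * q i ^+ 2)); last first.
    move=> i _; rewrite mulr_sumr.
    rewrite [RHS](eq_bigl (fun p => p \in E i)); last first.
      move=> p; case: (boolP (p \in E i)) => [/(subsetP (ED i)) -> //|_].
      by rewrite andbF.
    by apply: eq_bigr => p _; rewrite mulrC.
  rewrite (exchange_big_dep (mem D)) /=; last by move=> i p _ /andP[].
  apply: eq_bigr => p hp; rewrite mulr_sumr; apply: eq_bigl => i.
  by rewrite inE hp.
by apply: ler_sum => p _; exact: sqr_sum_le.
Qed.

Section Core.
Variables (xi0 : F) (E0 : {set F * F}) (h : R) (v : F).
Hypotheses (xi00 : xi0 != 0) (xi01 : xi0 != 1).
Hypothesis E0_sub : E0 \subset ratio_edges xi0.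
Hypothesis h0 : 0 < h.
Hypothesis E0_deg : mindeg E0 h.

Let E0P y x : (y, x) \in E0 ->
  [/\ y \in A, x \in A & apex xi0 y x \in A].
Proof. by move=> /(subsetP E0_sub)/ratio_edgesP[]. Qed.

(** A difference inside the core is [(1 - xi0)((a1 - a2) - (a3 - a4))] for many
    quadruples from [A]: go from [y] to [y'] through a common good partner
    [z], and from each of them to [z] through common neighbours [x], [x']. *)
Lemma card_core_diff (eta : R) : 0 <= eta ->
  #|core E0 h eta v :+: -: core E0 h eta v|%:R * (h / 2 * eta ^+ 2) <= N ^+ 4.
Proof.
move=> eta0; set P := core E0 h eta v.
pose D := setX (setX A A) (setX A A).
have -> : N ^+ 4 = #|D|%:R by rewrite !cardsX -natrX; congr (_%:R); ring.
pose f (t : (F * F) * (F * F)) := (1 - xi0) * ((t.1.1 - t.1.2) - (t.2.1 - t.2.2)).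
apply: (@card_fibers _ _ _ f) => d /sumsetP[y [y1 [hy]]].
rewrite mem_oppset; set y' := - y1 => hy' ->; have -> : y1 = - y' by rewrite opprK.
pose G := [set z in lnbr E0 v | (eta <= (codeg E0 y z)%:R) && (eta <= (codeg E0 y' z)%:R)].
pose K := [set k : F * (F * F) | [&& k.1 \in G,
   k.2.1 \in rnbr E0 y :&: rnbr E0 k.1 & k.2.2 \in rnbr E0 y' :&: rnbr E0 k.1]].
have hK : h / 2 * eta ^+ 2 <= #|K|%:R.
  have hG := core_common E0_deg hy hy'; rewrite -/G in hG.
  apply: le_trans (ler_wpM2r (sqr_ge0 _) hG) _.
  apply: (@card_fibers _ _ _ (fun k => k.1)) => z hz.
  have : (#|setX (rnbr E0 y :&: rnbr E0 z) (rnbr E0 y' :&: rnbr E0 z)|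
          <= #|[set t in K | t.1 == z]|)%N.
    apply: (@card_injectS _ _ (fun p => (z, p))); first by move=> p p' _ _ [].
    by move=> [p p'] hp; rewrite inE eqxx andbT inE hz /= -in_setX.
  rewrite -(ler_nat R); apply: le_trans; rewrite cardsX natrM expr2.
  by move: hz; rewrite inE => /andP[_ /andP[h1 h2]]; exact: ler_pM.
apply: le_trans hK _; rewrite ler_nat.
apply: (@card_injectS _ _ (fun k : F * (F * F) =>
  ((apex xi0 y k.2.1, apex xi0 k.1 k.2.1), (apex xi0 y' k.2.2, apex xi0 k.1 k.2.2)))).
  move=> [z [x x']] [z1 [x1 x1']] _ _ /= [e1 e2 e3 e4].
  have xx w u1 u2 : apex xi0 w u1 = apex xi0 w u2 -> u1 = u2.
    move=> e; apply: (mulfI xi00).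
    by have := apexE w u1 xi01; rewrite {1}(apexE w u2 xi01) e => /addrI ->.
  move: e2; rewrite (xx _ _ _ e1) (xx _ _ _ e3) => e2.
  by rewrite (apexE z x1 xi01) e2 -(apexE z1 x1 xi01).
move=> [z [x x']]; rewrite !inE /= => /and3P[hz /andP[yx zx] /andP[y'x' zx']].
have [_ _ ->] := E0P yx; have [_ _ ->] := E0P zx.
have [_ _ ->] := E0P y'x'; have [_ _ ->] := E0P zx'.
rewrite /=; apply/eqP; rewrite /f /=.
rewrite {2}(apexE y x xi01) {2}(apexE y' x' xi01).
transitivity (((1 - xi0) * apex xi0 y x + xi0 * x - ((1 - xi0) * apex xi0 z x + xi0 * x))
  - ((1 - xi0) * apex xi0 y' x' + xi0 * x' - ((1 - xi0) * apex xi0 z x' + xi0 * x'))).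
  by ring.
by rewrite -(apexE z x xi01) -(apexE z x' xi01); ring.
Qed.

Variable P : {set F}.
Variable m : R.

(** The other side of the core: the vertices of [A] joined to many elements of
    [P]. *)
Definition popular_partners : {set F} :=
  [set x in A | m <= #|[set y in P | (y, x) \in E0]|%:R].

Local Notation S := popular_partners.
Hypothesis m0 : 0 <= m.

(** Write [y' - xi0 x] as [(y' - y) + (1 - xi0) a], where [y] runs over the
    neighbours of [x] in [P]. *)
Lemma card_core_partner :
  #|P :+: -: (xi0 *:: S)|%:R * m <= #|P :+: -: P|%:R * N.
Proof.
rewrite -natrM -cardsX.
pose f (t : F * F) := t.1 + (1 - xi0) * t.2.
apply: (@card_fibers _ _ _ f) => d /sumsetP[y' [x1 [hy']]].
rewrite mem_oppset => /imsetP[x hx ex] ->; have {ex} -> : x1 = - (xi0 * x).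
  by rewrite -ex opprK.
move: hx; rewrite inE => /andP[xA hx]; apply: le_trans hx _; rewrite ler_nat.
apply: (@card_injectS _ _ (fun y => (y' - y, apex xi0 y x))).
  by move=> y1 y2 _ _ [/addrI/oppr_inj].
move=> y; rewrite inE => /andP[yP yx]; rewrite !inE /=.
have [_ _ ->] := E0P yx; rewrite mem_sumset ?mem_oppset ?opprK //=.
by rewrite /f /=; apply/eqP; rewrite {1}(apexE y x xi01); ring.
Qed.

(** Each of [xi0 x] and [xi0 x'] is an element of [P] minus an element of
    [(1 - xi0) A], in many ways. *)
Lemma card_partner_diff :
  #|S :+: -: S|%:R * m ^+ 2 <= #|P :+: -: P|%:R * N ^+ 2.
Proof.
have -> : #|P :+: -: P|%:R * N ^+ 2 = #|setX (P :+: -: P) (setX A A)|%:R :> R.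
  by rewrite !cardsX !natrM expr2.
pose f (t : F * (F * F)) := (t.1 - (1 - xi0) * (t.2.1 - t.2.2)) / xi0.
apply: (@card_fibers _ _ _ f) => d /sumsetP[x [x1 [hx]]].
rewrite mem_oppset; set x' := - x1 => hx' ->; have -> : x1 = - x' by rewrite opprK.
move: hx hx'; rewrite !inE => /andP[_ hx] /andP[_ hx'].
have : m ^+ 2 <= #|setX [set y in P | (y, x) \in E0] [set y in P | (y, x') \in E0]|%:R.
  by rewrite cardsX natrM expr2; exact: ler_pM.
move=> /le_trans; apply; rewrite ler_nat.
apply: (@card_injectS _ _ (fun p => (p.1 - p.2, (apex xi0 p.1 x, apex xi0 p.2 x')))).
  move=> [y1 y2] [z1 z2] _ _ /= [e1 e2 e3].
  by rewrite (apexE y1 x xi01) e2 -(apexE z1 x xi01) (apexE y2 x' xi01) e3 -(apexE z2 x' xi01).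
move=> [y y']; rewrite !inE /= => /andP[/andP[yP yx] /andP[y'P y'x']].
have [_ _ ->] := E0P yx; have [_ _ ->] := E0P y'x'.
rewrite mem_sumset ?mem_oppset ?opprK //= /f /=; apply/eqP.
have -> : y - y' - (1 - xi0) * (apex xi0 y x - apex xi0 y' x') = xi0 * (x - x').
  by rewrite {1}(apexE y x xi01) {1}(apexE y' x' xi01); ring.
by rewrite mulrC mulKf // opprK.
Qed.

End Core.
End Structure.

(** * A structured subset from many collinear triples *)

Section StructureTheorem.
Variables (R : realFieldType) (F : finFieldType) (A : {set F}).
Implicit Types (xi a x y v z : F) (Xi : {set F}).

Local Notation N := (#|A|%:R : R).

Lemma sum_pairs (E : {set F * F}) (P : {set F}) (g : F * F -> R) :
  \sum_(y in P) \sum_(x in rnbr E y) g (y, x) = \sum_(p in E | p.1 \in P) g p.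
Proof.
rewrite pair_big_dep /=; apply: eq_big => [[y x]|[y x] _] //=.
by rewrite inE andbC.
Qed.

(** Trim each graph [ratio_edges xi] to minimum degree [Q xi / (4 N)], where
    [Q xi] is its number of edges, and choose [xi0] with probability
    proportional to [Q xi0].  With this weight, Cauchy-Schwarz bounds the mean
    number of edges shared with the other graphs without splitting the ratios
    into dyadic levels, so no logarithm is lost, and a single factor [delta ^ 2]
    is spent on the mass of the core. *)
Lemma popular_core (delta : R) Xi :
  0 < N -> 0 < delta -> 1 \notin Xi ->
  (forall xi, xi \in Xi -> delta * N ^+ 2 <= #|ratio_edges A xi|%:R) ->
  delta * N ^+ 5 <= \sum_(xi in Xi) #|ratio_edges A xi|%:R ^+ 2 ->
  exists (E : F -> {set F * F}) (xi0 : F) (h : R) (P : {set F}),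
    [/\ [/\ xi0 \in Xi, forall xi, E xi \subset ratio_edges A xi,
          mindeg (E xi0) h & delta * N / 4 <= h],
        exists v, P = core (E xi0) h (h ^+ 2 / (8 * N)) v
      & delta ^+ 2 * N ^+ 3 / 32 <=
        \sum_(p in E xi0 | p.1 \in P) #|[set xi in Xi | p \in E xi]|%:R].
Proof.
move=> N0 d0 Xi1 XiQ hsum.
pose Q xi : R := #|ratio_edges A xi|%:R; pose h xi := Q xi / (4 * N).
have h0 xi : 0 <= h xi by rewrite divr_ge0 // mulr_ge0.
have /fin_all_exists[E hE] xi : exists E' : {set F * F},
    [/\ E' \subset ratio_edges A xi, mindeg E' (h xi) & Q xi / 2 <= #|E'|%:R].
  have [E' [sE' dE' cE']] := @mindeg_subgraph R F F (ratio_edges A xi) (h xi) (h0 xi).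
  exists E'; split=> //; apply: le_trans cE'; rewrite -/(Q xi).
  have im g : (forall p, p \in ratio_edges A xi -> g p \in A) ->
      (#|[set g e | e in ratio_edges A xi]|%:R : R) <= N.
    move=> hg; rewrite ler_nat; apply: subset_leq_card.
    by apply/subsetP => _ /imsetP[p hp ->]; exact: hg.
  have i1 : (#|[set e.1 | e in ratio_edges A xi]|%:R : R) <= N.
    by apply: im => p /ratio_edgesP[].
  have i2 : (#|[set e.2 | e in ratio_edges A xi]|%:R : R) <= N.
    by apply: im => p /ratio_edgesP[].
  have : h xi * (#|[set e.1 | e in ratio_edges A xi]|%:R + #|[set e.2 | e in ratio_edges A xi]|%:R)
      <= h xi * (N + N) by rewrite ler_wpM2l // lerD.
  have -> : h xi * (N + N) = Q xi / 2 by rewrite /h; field; rewrite gt_eqF.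
  lra.
have Es xi : E xi \subset ratio_edges A xi by case: (hE xi).
have EA xi : E xi \subset setX A A := subset_trans (Es xi) (ratio_edges_sub A xi).
pose U p : R := #|[set xi in Xi | p \in E xi]|%:R.
have Qpos xi : xi \in Xi -> 0 < Q xi.
  by move=> /XiQ; apply: lt_le_trans; rewrite mulr_gt0 // exprn_gt0.
have Xin : Xi != set0.
  apply: contraTneq hsum => ->; rewrite big_set0 -ltNge mulr_gt0 // exprn_gt0 //.
(* [delta N^5 / 2] edges weighted by [Q], spread over [N^2] pairs *)
have overlap : delta ^+ 2 * N ^+ 8 / 4 <= \sum_(xi in Xi) Q xi ^+ 2 * \sum_(p in E xi) U p.
  have le1 : delta * N ^+ 5 / 2 <= \sum_(xi in Xi) Q xi * #|E xi|%:R.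
    apply: le_trans (_ : \sum_(xi in Xi) Q xi * (Q xi / 2) <= _).
      rewrite ler_pdivrMr // mulr_suml (le_trans hsum) //.
      by apply: ler_sum => xi _; rewrite mulrA divfK ?pnatr_eq0 // expr2.
    by apply: ler_sum => xi _; rewrite ler_wpM2l //; case: (hE xi).
  have := @weighted_overlap R _ _ Xi (setX A A) E Q EA.
  rewrite cardsX natrM -expr2 -/U => le2.
  have le3 : (delta * N ^+ 5 / 2) ^+ 2 <= N ^+ 2 * \sum_(xi in Xi) Q xi ^+ 2 * \sum_(p in E xi) U p.
    apply: le_trans le2; rewrite ler_pXn2r ?nnegrE //.
      by rewrite divr_ge0 // mulr_ge0 ?exprn_ge0 // ltW.
    by apply: sumr_ge0 => xi _; rewrite mulr_ge0.
  rewrite -(ler_pM2l (exprn_gt0 2 N0)); apply: le_trans le3.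
  by rewrite le_eqVlt; apply/orP; left; apply/eqP; field.
pose w xi y := \sum_(x in rnbr (E xi) y) U (y, x).
pose eta xi := h xi ^+ 2 / (8 * N).
pose mass xi v := \sum_(y in core (E xi) (h xi) (eta xi) v) w xi y.
have cores xi : xi \in Xi ->
    h xi / 2 * \sum_(p in E xi) U p <= \sum_(v in A) mass xi v.
  move=> hxi; case: (hE xi) => _ dE _.
  have -> : \sum_(p in E xi) U p = \sum_(y in A | rnbr (E xi) y != set0) w xi y.
    rewrite big_mkcondr /=.
    rewrite (eq_bigr (w xi)); last first.
      by move=> y _; case: eqVneq => // e; rewrite /w e big_set0.
    rewrite /w sum_pairs; apply: eq_bigl => p.
    by case: (boolP (p \in E xi)) => // /(subsetP (EA xi)); rewrite inE => /andP[-> _].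
  apply: (@core_weight R F F (E xi) (h xi) N A A (w xi)) => //.
  - by rewrite divr_gt0 ?Qpos // mulr_gt0.
  - by move=> e /(subsetP (EA xi)); rewrite inE => /andP[].
  - by move=> y; apply: sumr_ge0 => x _; exact: ler0n.
have [|xi0 hxi0 hm] := @weighted_pigeonhole R _ Xi Q
    (fun xi => \sum_(v in A) mass xi v) (delta ^+ 2 * N ^+ 4 / 32) Xin Qpos.
  apply: le_trans (_ : \sum_(xi in Xi) Q xi * (h xi / 2 * \sum_(p in E xi) U p) <= _); last first.
    by apply: ler_sum => xi hxi; apply: ler_wpM2l => //; exact: cores.
  have -> : \sum_(xi in Xi) Q xi * (h xi / 2 * \sum_(p in E xi) U p) =
      (8 * N)^-1 * \sum_(xi in Xi) Q xi ^+ 2 * \sum_(p in E xi) U p.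
    rewrite mulr_sumr; apply: eq_bigr => xi _; rewrite /h; field.
    by rewrite gt_eqF.
  have sQ : \sum_(xi in Xi) Q xi <= N ^+ 3.
    by rewrite -natr_sum -natrX ler_nat sum_ratio_edges.
  apply: le_trans (ler_wpM2l _ sQ) _.
    by rewrite divr_ge0 // mulr_ge0 ?exprn_ge0 // ltW.
  rewrite [leRHS]mulrC ler_pdivlMr ?mulr_gt0 //; apply: le_trans overlap.
  by rewrite le_eqVlt; apply/orP; left; apply/eqP; field.
have A0 : A != set0 by rewrite -card_gt0 -(ltr_nat R).
have [|v _ hv] := @weighted_pigeonhole R _ A (fun=> 1) (mass xi0)
    (delta ^+ 2 * N ^+ 3 / 32) A0 (fun _ _ => ltr01).
  rewrite sumr_const; under [leRHS]eq_bigr do rewrite mul1r.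
  apply: le_trans hm; rewrite le_eqVlt; apply/orP; left; apply/eqP.
  by field.
exists E, xi0, (h xi0), (core (E xi0) (h xi0) (eta xi0) v); split.
- split=> //; first by case: (hE xi0).
  rewrite /h ler_pdivlMr ?mulr_gt0 //; apply: le_trans (XiQ _ hxi0).
  by rewrite le_eqVlt; apply/orP; left; apply/eqP; field.
- by exists v.
- by apply: le_trans hv _; rewrite /mass /w sum_pairs.
Qed.

(** The set [a + c Z] lives in the core [P] of [popular_core], and its
    parameters [z] are themselves ratios whose graphs are dense between [P] and
    its partners [S]: fixing two of the three points of a triple makes the third
    an affine function of the ratio.  This is what later lets quotients of
    differences of that set act on [P] as combinations of dilates [z S].  Its
    size [delta ^ 2 N] governs how strong a non-concentration hypothesis on
    cosets of subfields has to be. *)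
Lemma collinear_structure (delta : R) Xi :
  0 < N -> 0 < delta -> 0 \notin Xi -> 1 \notin Xi ->
  (forall xi, xi \in Xi -> delta * N ^+ 2 <= #|ratio_edges A xi|%:R) ->
  delta * N ^+ 5 <= \sum_(xi in Xi) #|ratio_edges A xi|%:R ^+ 2 ->
  exists (P S Z : {set F}) (xi0 a c : F),
    [/\ [/\ xi0 != 0, c != 0, 0 \notin Z, [set a + c * z | z in Z] \subset P
          & P \subset A],
        delta ^+ 2 * N <= 128 * #|Z|%:R,
        [/\ #|P :+: -: P|%:R * delta ^+ 5 <= 2 ^+ 17 * N,
            #|P :+: -: (xi0 *:: S)|%:R * delta ^+ 2 <= 64 * #|P :+: -: P|%:R
          & #|S :+: -: S|%:R * delta ^+ 4 <= 64 ^+ 2 * #|P :+: -: P|%:R]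
      & forall z, z \in Z -> exists t,
          delta ^+ 3 * N <= 128 * #|P :&: (z *:: S :+: [set t])|%:R].
Proof.
move=> N0 d0 Xi0 Xi1 XiQ hsum.
have [E [xi0 [h [P [[hxi0 Es dE hh] [v Pv] hmass]]]]] := popular_core N0 d0 Xi1 XiQ hsum.
have n0 xi : xi \in Xi -> xi != 0 by apply: contraTneq => ->.
have n1 xi : xi \in Xi -> xi != 1 by apply: contraTneq => ->.
have xi00 := n0 _ hxi0; have xi01 := n1 _ hxi0.
have h0 : 0 < h by apply: lt_le_trans hh; rewrite divr_gt0 // mulr_gt0.
set eta := h ^+ 2 / (8 * N) in Pv.
have eta0 : 0 <= eta by rewrite divr_ge0 ?sqr_ge0 // ltW // mulr_gt0.
pose m := delta ^+ 2 * N / 64.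
have m0 : 0 <= m by rewrite divr_ge0 // mulr_ge0 ?exprn_ge0 // ltW.
pose S := popular_partners A (E xi0) P m.
have bPP : #|P :+: -: P|%:R * delta ^+ 5 <= 2 ^+ 17 * N.
  have := card_core_diff v xi00 xi01 (Es xi0) dE eta0; rewrite -Pv => b.
  have le1 : delta ^+ 5 * N ^+ 3 / 2 ^+ 17 <= h / 2 * eta ^+ 2.
    have -> : h / 2 * eta ^+ 2 = h ^+ 5 / (128 * N ^+ 2).
      by rewrite /eta; field; rewrite gt_eqF.
    rewrite ler_pdivlMr ?mulr_gt0 ?exprn_gt0 //.
    have -> : delta ^+ 5 * N ^+ 3 / 2 ^+ 17 * (128 * N ^+ 2) = (delta * N / 4) ^+ 5.
      by field.
    by rewrite ler_pXn2r ?nnegrE // ltW // divr_gt0 // mulr_gt0.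
  have b' := le_trans (ler_wpM2l (ler0n _ _) le1) b.
  rewrite -(ler_pM2r (exprn_gt0 3 N0)).
  have -> : #|P :+: -: P|%:R * delta ^+ 5 * N ^+ 3 =
    2 ^+ 17 * (#|P :+: -: P|%:R * (delta ^+ 5 * N ^+ 3 / 2 ^+ 17)) by field.
  by rewrite -[leRHS]mulrA -exprS ler_pM2l ?exprn_gt0.
have bPS : #|P :+: -: (xi0 *:: S)|%:R * delta ^+ 2 <= 64 * #|P :+: -: P|%:R.
  have b := @card_core_partner R F A xi0 (E xi0) xi01 (Es xi0) P m.
  move: b; set x := #|_ :+: -: (xi0 *:: S)|%:R => b.
  rewrite -(ler_pM2r N0) (_ : x * _ * N = 64 * (x * m)); last by rewrite /m; field.
  by rewrite -[leRHS]mulrA ler_pM2l.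
have bSS : #|S :+: -: S|%:R * delta ^+ 4 <= 64 ^+ 2 * #|P :+: -: P|%:R.
  have b := @card_partner_diff R F A xi0 (E xi0) xi00 xi01 (Es xi0) P m m0.
  move: b; set x := #|S :+: -: S|%:R => b.
  rewrite -(ler_pM2r (exprn_gt0 2 N0)).
  rewrite (_ : x * _ * N ^+ 2 = 64 ^+ 2 * (x * m ^+ 2)); last by rewrite /m; field.
  by rewrite -[leRHS]mulrA ler_pM2l ?exprn_gt0.
(* vertices outside [S] carry at most half of the mass found by [popular_core] *)
pose U p : R := #|[set xi in Xi | p \in E xi]|%:R.
have U_le p : U p <= N.
  rewrite ler_nat; apply: leq_trans (card_colours A p Xi1); apply: subset_leq_card.
  by apply/subsetP => xi; rewrite !inE => /andP[-> /(subsetP (Es xi))]; rewrite inE.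
pose D := [set p in E xi0 | (p.1 \in P) && (p.2 \in S)].
have hD : delta ^+ 2 * N ^+ 3 / 64 <= \sum_(p in D) U p.
  have := hmass; rewrite (bigID (fun p => p.2 \in S)) /=.
  rewrite (eq_bigl (mem D)); last by move=> p; rewrite [RHS]inE andbA.
  rewrite [X in _ <= _ + X](eq_bigl (fun p => (p \in E xi0) && ((p.1 \in P) && (p.2 \notin S))));
    last by move=> p; rewrite andbA.
  suff : \sum_(p in E xi0 | (p.1 \in P) && (p.2 \notin S)) #|[set xi in Xi | p \in E xi]|%:R
      <= delta ^+ 2 * N ^+ 3 / 64 by rewrite /= -/U; set x := \sum_(_ in D) _; lra.
  apply: le_trans (_ : \sum_(p in E xi0 | (p.1 \in P) && (p.2 \notin S)) N <= _).
    by apply: ler_sum => p _; exact: U_le.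
  rewrite (partition_big snd (mem A)) /=; last first.
    by move=> p /andP[/(subsetP (Es xi0))/ratio_edgesP[]].
  have -> : delta ^+ 2 * N ^+ 3 / 64 = \sum_(x in A) m * N.
    by rewrite sumr_const -mulr_natr /m; field.
  apply: ler_sum => x xA; rewrite sumr_const -[leLHS]mulr_natl ler_wpM2r //.
  have [xS|xS] := boolP (x \in S).
    rewrite (_ : #|_| = 0%N) //; apply: eq_card0 => p; rewrite !inE.
    apply/negP => /andP[/and3P[_ _ +] /eqP e]; rewrite e; move: xS; rewrite inE => ->.
    by [].
  move: (xS); rewrite inE xA /= -ltNge => /ltW; apply: le_trans; rewrite ler_nat.
  apply: (@leq_trans #|[set p in E xi0 | (p.1 \in P) && (p.2 == x)]|).
    by apply: subset_leq_card; apply/subsetP => p; rewrite !inE => /andP[/and3P[-> -> _] ->].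
  apply: (@card_injectS _ _ fst).
    move=> [y x1] [y' x2]; rewrite !inE /= => /and3P[_ _ /eqP ->] /and3P[_ _ /eqP ->].
    by move=> ->.
  by move=> [y x1]; rewrite !inE /= => /and3P[h1 -> /eqP <-].
(* there are at most [N / delta] ratios, so those with fewer than [theta N^2]
   edges in [D] carry at most half of the remaining mass *)
pose theta := delta ^+ 3 / 128.
pose Xi2 := [set xi in Xi | theta * N ^+ 2 <= #|E xi :&: D|%:R].
have hXi2 : delta ^+ 2 * N ^+ 3 / 128 <= (\sum_(xi in Xi2) #|E xi :&: D|)%:R.
  have : (\sum_(xi in Xi) #|E xi :&: D|)%:R = \sum_(p in D) U p.
    by rewrite exchange_colours natr_sum.
  rewrite (big_setID Xi2) /= (setIidPr _); last by apply/subsetP => xi; rewrite inE => /andP[].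
  rewrite natrD => e.
  suff : (\sum_(xi in Xi :\: Xi2) #|E xi :&: D|)%:R <= delta ^+ 2 * N ^+ 3 / 128 :> R.
    move=> h1; rewrite -e in hD; set x := _%:R in hD *; lra.
  rewrite natr_sum; apply: le_trans (_ : \sum_(xi in Xi) theta * N ^+ 2 <= _).
    rewrite [leRHS](big_setID Xi2) /= (setIidPr _); last by apply/subsetP => xi; rewrite inE => /andP[].
    rewrite -[leLHS]add0r; apply: lerD.
      by apply: sumr_ge0 => xi _; rewrite mulr_ge0 ?exprn_ge0 // divr_ge0 // exprn_ge0 // ltW.
    apply: ler_sum => xi; rewrite !inE => /andP[+ hxi].
    by rewrite hxi /= -ltNge => /ltW.
  have cXi : #|Xi|%:R * delta <= N.
    rewrite -(ler_pM2r (exprn_gt0 2 N0)) -mulrA -exprS mulr_natl -sumr_const.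
    apply: le_trans (_ : (\sum_(xi in Xi) #|ratio_edges A xi|)%:R <= _).
      by rewrite natr_sum; exact: ler_sum.
    by rewrite -natrX ler_nat sum_ratio_edges.
  rewrite sumr_const -[leLHS]mulr_natl /theta.
  have -> : #|Xi|%:R * (delta ^+ 3 / 128 * N ^+ 2) =
    (#|Xi|%:R * delta) * (delta ^+ 2 * N ^+ 2 / 128) by field.
  have -> : delta ^+ 2 * N ^+ 3 / 128 = N * (delta ^+ 2 * N ^+ 2 / 128) by field.
  by rewrite ler_wpM2r // divr_ge0 // mulr_ge0 ?exprn_ge0 // ltW.
pose K := [set k : F * (F * F) | (k.1 \in Xi2) && (k.2 \in E k.1 :&: D)].
have cK : #|K| = (\sum_(xi in Xi2) #|E xi :&: D|)%N.
  rewrite -sum1_card (eq_bigr (fun xi => \sum_(p in E xi :&: D) 1)%N); last first.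
    by move=> xi _; rewrite sum1_card.
  by rewrite pair_big_dep /=; apply: eq_bigl => k; rewrite inE.
have K0 : K != set0.
  rewrite -card_gt0 cK -(ltr_nat R); apply: lt_le_trans hXi2.
  by rewrite divr_gt0 // mulr_gt0 // exprn_gt0.
pose g (k : F * (F * F)) := (apex k.1 k.2.1 k.2.2, k.2.2).
have [|[a0 x0] _ ha] := @pigeonhole _ _ g K (setX A A) K0.
  move=> [xi [y x]]; rewrite !inE /= => /andP[_ /andP[/(subsetP (Es xi))/ratio_edgesP[/= _ -> _ -> _]]].
  by [].
pose Z := [set xi in Xi2 | ((1 - xi) * a0 + xi * x0, x0) \in E xi :&: D].
have cZ : delta ^+ 2 * N <= 128 * #|Z|%:R.
  have le1 : (#|[set k in K | g k == (a0, x0)]| <= #|Z|)%N.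
    have key k : k \in [set k in K | g k == (a0, x0)] ->
        [/\ k.1 \in Xi2, k.2 \in E k.1 :&: D & k.2 = ((1 - k.1) * a0 + k.1 * x0, x0)].
      case: k => [xi [y x]]; rewrite inE => /andP[]; rewrite inE /= => /andP[hxi hp].
      rewrite /g /= => /eqP[e1 e2]; split=> //; rewrite -e1 -e2 -apexE //.
      by apply: n1; move: hxi; rewrite inE => /andP[].
    apply: (@card_injectS _ _ fst).
      by move=> k k' /key[_ _ e] /key[_ _ e'] /= ek; move: e e'; rewrite -ek;
        case: k ek => ? ?; case: k' => ? ? /= -> -> ->.
    by move=> k /key[h1 h2 e]; rewrite inE h1 -e.
  have := leq_trans ha (leq_mul (leqnn _) le1); rewrite -(ler_nat R) cK => le2.
  have := le_trans hXi2 le2; rewrite cardsX !natrM => le3.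
  rewrite -(ler_pM2r (exprn_gt0 2 N0)); move: le3; rewrite ler_pdivrMr // => le3.
  rewrite (_ : _ * N ^+ 2 = delta ^+ 2 * N ^+ 3); last by ring.
  by apply: le_trans le3 _; rewrite le_eqVlt; apply/orP; left; apply/eqP; ring.
have Z0 : Z != set0.
  rewrite -card_gt0 -(ltr_nat R); rewrite -(pmulr_rgt0 _ (ltr0n R 128)).
  by apply: lt_le_trans cZ; rewrite mulr_gt0 // exprn_gt0.
have ZXi2 z : z \in Z -> z \in Xi2 by rewrite inE => /andP[].
have ZXi z : z \in Z -> z \in Xi by move=> /ZXi2; rewrite inE => /andP[].
exists P, S, Z, xi0, a0, (x0 - a0); split=> //.
- split=> //.
  + case/set0Pn: Z0 => z hz; rewrite subr_eq0.
    move: hz; rewrite inE => /andP[_ /setIP[/(subsetP (Es z))/ratio_edgesP[/= _ _ + _] _]].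
    by apply: contraNneq => ->; apply/eqP; ring.
  + by apply/negP => /ZXi; exact/negP.
  + apply/subsetP => _ /imsetP[z + ->]; rewrite inE => /andP[_ /setIP[_]].
    rewrite inE /= => /and3P[_ hP _].
    by have <- : (1 - z) * a0 + z * x0 = a0 + (x0 - a0) * z by ring.
  + apply/subsetP => y; rewrite Pv inE => /andP[+ _]; rewrite inE.
    by move=> /(subsetP (Es xi0))/ratio_edgesP[].
- move=> z hz; have := ZXi2 _ hz; rewrite inE => /andP[hzXi hth].
  have Dn : E z :&: D != set0.
    rewrite -card_gt0 -(ltr_nat R); apply: lt_le_trans hth.
    by rewrite mulr_gt0 ?exprn_gt0 // divr_gt0 // exprn_gt0.
  have [|a _ hfib] := @pigeonhole _ _ (fun p => apex z p.1 p.2) (E z :&: D) A Dn.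
    by move=> p /setIP[/(subsetP (Es z))/ratio_edgesP[]].
  exists ((1 - z) * a).
  have key p : p \in [set t in E z :&: D | apex z t.1 t.2 == a] ->
      [/\ p.1 \in P, p.2 \in S & p.1 = z * p.2 + (1 - z) * a].
    rewrite inE => /andP[/setIP[_]]; rewrite inE => /and3P[_ -> ->] /eqP <-; split=> //.
    by rewrite {1}(@apexE F z p.1 p.2) ?n1 // addrC.
  have le1 : (#|[set t in E z :&: D | apex z t.1 t.2 == a]| <=
      #|P :&: (z *:: S :+: [set ((1 - z) * a)%R])|)%N.
    apply: (@card_injectS _ _ fst).
      move=> [y x] [y' x'] /key[/= _ _ e] /key[/= _ _ e'] ey.
      congr (_, _) => //; apply: (mulfI (n0 _ hzXi)).
      by apply: (addIr ((1 - z) * a)); rewrite -e -e'.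
    by move=> p /key[h1 h2 e]; rewrite inE h1 /= e mem_sumset ?mem_scaleset ?set11.
  have := leq_trans hfib (leq_mul (leqnn _) le1); rewrite -(ler_nat R) natrM => le2.
  have := le_trans hth le2; rewrite expr2 mulrA mulrC ler_pM2l //.
  by rewrite /theta mulrAC ler_pdivrMr // [leRHS]mulrC.
Qed.

End StructureTheorem.

(** * Bounding the density of collinear triples *)

Section Numerics.
Variable R : realFieldType.
Implicit Types (N k w d p u s e c g : R).

(** In the three lemmas below [e] stands for [1 / delta], [k] and [w] for the
    sizes of [B] and [P], [p], [u], [s] for those of [P - P], [P - xi0 S],
    [S - S], and [d] for the size of the bridges. *)
Lemma numeric_add N k w d p u e c : 0 < N -> 0 <= k -> 0 <= w -> 0 <= d ->
  0 <= p -> 0 <= u -> 1 <= e -> 1 <= c ->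
  N <= c * e ^+ 2 * k -> N <= c * e ^+ 2 * w -> N <= c * e ^+ 3 * d ->
  p <= c * e ^+ 5 * N -> u <= c * e ^+ 7 * N ->
  k ^+ 2 * w ^+ 6 * d ^+ 4 <= p ^+ 7 * u ^+ 4 ->
  N <= c ^+ 23 * e ^+ 91.
Proof.
move=> N0 k0 w0 d0 p0 u0 e1 c1 hk hw hd hp hu h.
have N0' := ltW N0; have e0 : 0 <= e := le_trans ler01 e1.
have c0 : 0 <= c := le_trans ler01 c1.
have g0 i x : 0 <= x -> 0 <= c * e ^+ i * x.
  by move=> x0; rewrite mulr_ge0 // mulr_ge0 // exprn_ge0.
rewrite -(ler_pM2r (exprn_gt0 11 N0)).
have le1 : N ^+ 2 * N ^+ 6 * N ^+ 4 <=
    (c * e ^+ 2 * k) ^+ 2 * (c * e ^+ 2 * w) ^+ 6 * (c * e ^+ 3 * d) ^+ 4.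
  by rewrite !(ler_pM, lerXn2r, mulr_ge0, exprn_ge0) // nnegrE ?g0.
have le2 : p ^+ 7 * u ^+ 4 <= (c * e ^+ 5 * N) ^+ 7 * (c * e ^+ 7 * N) ^+ 4.
  by rewrite !(ler_pM, lerXn2r, mulr_ge0, exprn_ge0) // nnegrE ?g0.
have -> : N * N ^+ 11 = N ^+ 2 * N ^+ 6 * N ^+ 4 by ring.
apply: le_trans le1 _.
have -> : (c * e ^+ 2 * k) ^+ 2 * (c * e ^+ 2 * w) ^+ 6 * (c * e ^+ 3 * d) ^+ 4
  = c ^+ 12 * e ^+ 28 * (k ^+ 2 * w ^+ 6 * d ^+ 4) by ring.
apply: le_trans (ler_wpM2l _ (le_trans h le2)) _.
  by rewrite mulr_ge0 ?exprn_ge0.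
by rewrite le_eqVlt; apply/orP; left; apply/eqP; ring.
Qed.

Lemma numeric_mul N k w d p u s e c : 0 < N -> 0 <= k -> 0 <= w -> 0 <= d ->
  0 <= p -> 0 <= u -> 0 <= s -> 1 <= e -> 1 <= c ->
  N <= c * e ^+ 2 * k -> N <= c * e ^+ 2 * w -> N <= c * e ^+ 3 * d ->
  p <= c * e ^+ 5 * N -> u <= c * e ^+ 7 * N -> s <= c * e ^+ 9 * N ->
  k ^+ 2 * d ^+ 6 * w ^+ 3 <= u ^+ 3 * p ^+ 5 * s ^+ 2 ->
  N <= c ^+ 21 * e ^+ 92.
Proof.
move=> N0 k0 w0 d0 p0 u0 s0 e1 c1 hk hw hd hp hu hs h.
have N0' := ltW N0; have e0 : 0 <= e := le_trans ler01 e1.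
have c0 : 0 <= c := le_trans ler01 c1.
have g0 i x : 0 <= x -> 0 <= c * e ^+ i * x.
  by move=> x0; rewrite mulr_ge0 // mulr_ge0 // exprn_ge0.
rewrite -(ler_pM2r (exprn_gt0 10 N0)).
have le1 : N ^+ 2 * N ^+ 6 * N ^+ 3 <=
    (c * e ^+ 2 * k) ^+ 2 * (c * e ^+ 3 * d) ^+ 6 * (c * e ^+ 2 * w) ^+ 3.
  by rewrite !(ler_pM, lerXn2r, mulr_ge0, exprn_ge0) // nnegrE ?g0.
have le2 : u ^+ 3 * p ^+ 5 * s ^+ 2 <=
    (c * e ^+ 7 * N) ^+ 3 * (c * e ^+ 5 * N) ^+ 5 * (c * e ^+ 9 * N) ^+ 2.
  by rewrite !(ler_pM, lerXn2r, mulr_ge0, exprn_ge0) // nnegrE ?g0.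
have -> : N * N ^+ 10 = N ^+ 2 * N ^+ 6 * N ^+ 3 by ring.
apply: le_trans le1 _.
have -> : (c * e ^+ 2 * k) ^+ 2 * (c * e ^+ 3 * d) ^+ 6 * (c * e ^+ 2 * w) ^+ 3
  = c ^+ 11 * e ^+ 28 * (k ^+ 2 * d ^+ 6 * w ^+ 3) by ring.
apply: le_trans (ler_wpM2l _ (le_trans h le2)) _.
  by rewrite mulr_ge0 ?exprn_ge0.
by rewrite le_eqVlt; apply/orP; left; apply/eqP; ring.
Qed.

Lemma numeric_subfield N g w d p u e c : 0 < N -> 0 <= g -> 0 <= w -> 0 <= d ->
  0 <= p -> 0 <= u -> 1 <= e -> 1 <= c ->
  N <= c * e ^+ 2 * w -> N <= c * e ^+ 3 * d ->
  p <= c * e ^+ 5 * N -> u <= c * e ^+ 7 * N ->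
  g * d ^+ 4 * w ^+ 3 <= 2 * (u ^+ 4 * p ^+ 4) ->
  g <= 2 * c ^+ 15 * e ^+ 66 * N.
Proof.
move=> N0 gg0 w0 d0 p0 u0 e1 c1 hw hd hp hu h.
have N0' := ltW N0; have e0 : 0 <= e := le_trans ler01 e1.
have c0 : 0 <= c := le_trans ler01 c1.
have g0 i x : 0 <= x -> 0 <= c * e ^+ i * x.
  by move=> x0; rewrite mulr_ge0 // mulr_ge0 // exprn_ge0.
rewrite -(ler_pM2r (exprn_gt0 7 N0)).
have le1 : N ^+ 4 * N ^+ 3 <= (c * e ^+ 3 * d) ^+ 4 * (c * e ^+ 2 * w) ^+ 3.
  by rewrite !(ler_pM, lerXn2r, mulr_ge0, exprn_ge0) // nnegrE ?g0.
have le2 : u ^+ 4 * p ^+ 4 <= (c * e ^+ 7 * N) ^+ 4 * (c * e ^+ 5 * N) ^+ 4.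
  by rewrite !(ler_pM, lerXn2r, mulr_ge0, exprn_ge0) // nnegrE ?g0.
have -> : g * N ^+ 7 = g * (N ^+ 4 * N ^+ 3) by ring.
apply: le_trans (ler_wpM2l gg0 le1) _.
have -> : g * ((c * e ^+ 3 * d) ^+ 4 * (c * e ^+ 2 * w) ^+ 3)
  = c ^+ 7 * e ^+ 18 * (g * d ^+ 4 * w ^+ 3) by ring.
apply: le_trans (ler_wpM2l _ (le_trans h (ler_wpM2l _ le2))) _ => //.
  by rewrite mulr_ge0 ?exprn_ge0.
by rewrite le_eqVlt; apply/orP; left; apply/eqP; ring.
Qed.

End Numerics.

Section EnergyBound.
Variables (R : realFieldType) (F : finFieldType) (A : {set F}).
Implicit Types (xi : F) (Xi G : {set F}).

Local Notation N := (#|A|%:R : R).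

(** The three cases of [pivot_trichotomy].  The exponent 92 is that of the
    multiplicative pivot.  In the subfield case, either the subfield is the
    whole field, which bounds its order, or the hypothesis on affine images of
    subfields applies to the structured set, of size at least
    [delta ^ 2 N / 128]. *)
Lemma energy_dichotomy (K M delta : R) Xi :
  0 < N -> 1 <= K -> 0 < delta <= 1 -> 0 \notin Xi -> 1 \notin Xi ->
  (forall xi, xi \in Xi -> delta * N ^+ 2 <= #|ratio_edges A xi|%:R) ->
  delta * N ^+ 5 <= \sum_(xi in Xi) #|ratio_edges A xi|%:R ^+ 2 ->
  (forall G c d, proper_subfield G ->
     #|A :&: affine_image c d G|%:R ^+ 2 <= K ^+ 2 * #|G|%:R \/
     #|A :&: affine_image c d G|%:R <= K * M) ->
  let c : R := 2 ^+ 29 in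
  [\/ N * delta ^+ 92 <= c ^+ 23 * K ^+ 2, delta ^+ 2 * N <= c * (K * M)
    | #|F|%:R * delta ^+ 66 <= c ^+ 16 * N].
Proof.
move=> N0 K1 /andP[d0 d1] Xi0 Xi1 XiQ hsum hG c.
have [P [S [Z [xi0 [a [b [[xi00 b0 Z0 BP PA] cZ [bPP bPS bSS] hbr]]]]]]] :=
  collinear_structure N0 d0 Xi0 Xi1 XiQ hsum.
set B := [set a + b * z | z in Z] in BP.
have cE : c = 2 ^+ 29 by [].
clearbody c.
have c1 : 1 <= c by rewrite cE exprn_ege1 // ler1n.
have K0 : 0 <= K := le_trans ler01 K1.
have K21 : 1 <= K ^+ 2 by rewrite exprn_ege1.
pose e := delta^-1.
have e1 : 1 <= e by rewrite invf_ge1.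
have e0 : 0 <= e := le_trans ler01 e1.
have c0 : 0 <= c := le_trans ler01 c1.
have eX i x y : x * delta ^+ i <= y -> x <= y * e ^+ i.
  by rewrite /e exprVn ler_pdivlMr ?exprn_gt0.
have eXl i x y : delta ^+ i * x <= y -> x <= y * e ^+ i.
  by rewrite mulrC; exact: eX.
have Xe i x y : x <= y * e ^+ i -> x * delta ^+ i <= y.
  by rewrite /e exprVn ler_pdivlMr ?exprn_gt0.
have small i y : (i <= 92)%N -> 0 <= y -> y <= c ^+ 23 * K ^+ 2 ->
    N <= y * e ^+ i -> N * delta ^+ 92 <= c ^+ 23 * K ^+ 2.
  move=> hi y0 hy hN; apply: Xe; apply: le_trans hN _.
  by apply: ler_pM => //; [exact: exprn_ge0|rewrite ler_weXn2l].
have powc i j : (i <= j)%N -> c ^+ i <= c ^+ j * K ^+ 2.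
  move=> hij; rewrite -[leLHS]mulr1 ler_pM ?exprn_ge0 //.
  by rewrite ler_weXn2l.
have lec i : (i <= 29)%N -> 2 ^+ i <= c by move=> hi; rewrite cE ler_weXn2l // ler1n.
have [Z2|Z2] := leqP #|Z| 1.
  constructor 1; apply: (@small 2 128) => //; last first.
    apply: eXl; apply: le_trans cZ _; rewrite ler_piMr //.
    by rewrite -[1]/(1%:R) ler_nat.
  apply: le_trans (powc 1%N 23%N isT); rewrite expr1.
  by apply: le_trans (lec 7%N isT); rewrite le_eqVlt; apply/orP; left; apply/eqP; ring.
have Zn : Z != set0 by rewrite -card_gt0 ltnW.
(* a natural number is needed here; the least admissible one is below every
   bridge *)
have exd : exists n : nat, delta ^+ 3 * N <= 128 * n%:R.
  by case/set0Pn: Zn => z /hbr[t ht]; eexists; exact: ht.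
pose d := ex_minn exd.
have hd : delta ^+ 3 * N <= 128 * d%:R by rewrite /d; case: ex_minnP.
have bridge z : z \in Z -> exists t, (d <= #|P :&: (z *:: S :+: [set t])|)%N.
  by move=> /hbr[t ht]; exists t; rewrite /d; case: ex_minnP => n _; apply.
have cB : #|B| = #|Z|.
  by rewrite card_imset // => z z' /addrI/(mulfI b0).
have P0 : P != set0.
  by case/set0Pn: Zn => z hz; apply/set0Pn; exists (a + b * z); apply/(subsetP BP)/imset_f.
have [t3 tPP] := iterated_sumset_bounds P0.
have := pivot_trichotomy xi00 bridge Z2 b0 (erefl B) BP Z0.
move: t3 tPP; rewrite cB.
have wk : #|Z|%:R <= #|P|%:R :> R by rewrite -cB ler_nat subset_leq_card.
have gk : N <= c * e ^+ 2 * #|Z|%:R.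
  rewrite mulrAC; apply: eXl; apply: le_trans cZ _; rewrite ler_wpM2r //.
  by apply: le_trans (lec 7%N isT); rewrite le_eqVlt; apply/orP; left; apply/eqP; ring.
have gw : N <= c * e ^+ 2 * #|P|%:R.
  by apply: le_trans gk _; rewrite ler_wpM2l // mulr_ge0 ?exprn_ge0.
have gd : N <= c * e ^+ 3 * d%:R.
  rewrite mulrAC; apply: eXl; apply: le_trans hd _; rewrite ler_wpM2r //.
  by apply: le_trans (lec 7%N isT); rewrite le_eqVlt; apply/orP; left; apply/eqP; ring.
have gp17 : #|P :+: -: P|%:R <= 2 ^+ 17 * e ^+ 5 * N.
  by rewrite mulrAC; apply: eX.
have gp : #|P :+: -: P|%:R <= c * e ^+ 5 * N.
  apply: le_trans gp17 _; apply: ler_wpM2r => //.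
  by apply: ler_wpM2r; rewrite ?exprn_ge0 // lec.
have gu : #|P :+: -: (xi0 *:: S)|%:R <= c * e ^+ 7 * N.
  apply: le_trans (eX _ _ _ bPS) _.
  apply: le_trans (_ : 64 * (2 ^+ 17 * e ^+ 5 * N) * e ^+ 2 <= _).
    by rewrite ler_wpM2r ?exprn_ge0 // ler_wpM2l.
  have -> : 64 * (2 ^+ 17 * e ^+ 5 * N) * e ^+ 2 = 2 ^+ 23 * e ^+ 7 * N by ring.
  apply: ler_wpM2r => //.
  by apply: ler_wpM2r; rewrite ?exprn_ge0 // lec.
have gs : #|S :+: -: S|%:R <= c * e ^+ 9 * N.
  apply: le_trans (eX _ _ _ bSS) _.
  apply: le_trans (_ : 64 ^+ 2 * (2 ^+ 17 * e ^+ 5 * N) * e ^+ 4 <= _).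
    by rewrite ler_wpM2r ?exprn_ge0 // ler_wpM2l // exprn_ge0.
  have -> : 64 ^+ 2 * (2 ^+ 17 * e ^+ 5 * N) * e ^+ 4 = c * e ^+ 9 * N.
    by rewrite cE; ring.
  by [].
have BA : B \subset A := subset_trans BP PA.
move: wk gk gw gd gp gu gs.
set k := #|Z|; set w := #|P|; set p := #|P :+: -: P|.
set u := #|P :+: -: (xi0 *:: S)|; set s := #|S :+: -: S|.
set PP := #|P :+: P :+: (-: P :+: -: P)|; set PPP := #|P :+: P :+: P|.
move=> wk gk gw gd gp gu gs t3 tPP [h|h|[G [a' [b' [Gd BG h]]]]].
- constructor 1.
  have h' : (k ^ 2 * w ^ 6 * d ^ 4 <= p ^ 7 * u ^ 4)%N.
    have -> : (k ^ 2 * w ^ 6 * d ^ 4 = k ^ 2 * w * d ^ 4 * w ^ 5)%N by ring.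
    apply: leq_trans (leq_mul h (leqnn _)) _.
    have -> : (PPP * (u ^ 4 * PP) * w ^ 5 = PPP * w ^ 2 * (PP * w ^ 3) * u ^ 4)%N by ring.
    have -> : (p ^ 7 = p ^ 3 * p ^ 4)%N by rewrite -expnD.
    by rewrite leq_mul // leq_mul.
  apply: (@small 91 (c ^+ 23)) => //; [exact: exprn_ge0|exact: powc|].
  apply: (numeric_add _ _ _ _ _ _ e1 c1 gk gw gd gp gu) => //.
  by move: h'; rewrite -(ler_nat R) !(natrX, natrM).
- constructor 1.
  have h' : (k ^ 2 * d ^ 6 * w ^ 3 <= u ^ 3 * p ^ 5 * s ^ 2)%N.
    apply: leq_trans (leq_mul h (leqnn _)) _.
    have -> : (u * p * (s ^ 2 * u ^ 2 * PP) * w ^ 3 = u ^ 3 * p * s ^ 2 * (PP * w ^ 3))%N by ring.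
    have -> : (u ^ 3 * p ^ 5 * s ^ 2 = u ^ 3 * p * s ^ 2 * p ^ 4)%N by ring.
    by rewrite leq_mul2l tPP orbT.
  apply: (@small 92 (c ^+ 21)) => //; [exact: exprn_ge0|exact: powc|].
  apply: (numeric_mul _ _ _ _ _ _ _ e1 c1 gk gw gd gp gu gs) => //.
  by move: h'; rewrite -(ler_nat R) !(natrX, natrM).
have hmin (g : nat) : (g * d ^ 4 <= 2 * (u ^ 4 * PP))%N ->
    g%:R <= 2 * c ^+ 15 * e ^+ 66 * N.
  move=> hg; apply: (numeric_subfield _ _ _ _ _ _ e1 c1 gw gd gp gu) => //.
  have : (g * d ^ 4 * w ^ 3 <= 2 * (u ^ 4 * p ^ 4))%N.
    apply: leq_trans (leq_mul hg (leqnn _)) _.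
    have -> : (2 * (u ^ 4 * PP) * w ^ 3 = 2 * u ^ 4 * (PP * w ^ 3))%N by ring.
    apply: leq_trans (leq_mul (leqnn _) tPP) _.
    by apply/eq_leq; ring.
  by rewrite -(ler_nat R) !(natrX, natrM).
have c2 : 2 <= c by apply: le_trans (lec 1%N isT); rewrite expr1.
have kK (x : R) : 1 <= x -> (k ^ 2)%:R <= x * (2 * c ^+ 15 * e ^+ 66 * N) ->
    N <= x * c ^+ 18 * e ^+ 70.
  move=> x1 hk; rewrite -(ler_pM2r N0).
  have x0 : 0 <= x := le_trans ler01 x1.
  apply: le_trans (_ : (c * e ^+ 2 * k%:R) ^+ 2 <= _).
    by rewrite expr2 ler_pM // ltW.
  rewrite exprMn; rewrite natrX in hk.
  apply: le_trans (ler_wpM2l (sqr_ge0 _) hk) _.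
  have -> : (c * e ^+ 2) ^+ 2 * (x * (2 * c ^+ 15 * e ^+ 66 * N)) =
     2 * (x * c ^+ 17 * e ^+ 70 * N) by ring.
  have -> : x * c ^+ 18 * e ^+ 70 * N = c * (x * c ^+ 17 * e ^+ 70 * N) by ring.
  by rewrite ler_wpM2r // !mulr_ge0 ?exprn_ge0 // ltW.
have fin (x : R) : 1 <= x -> x <= K ^+ 2 -> N <= x * c ^+ 18 * e ^+ 70 ->
    N * delta ^+ 92 <= c ^+ 23 * K ^+ 2.
  move=> x1 xK hN; have x0 : 0 <= x := le_trans ler01 x1.
  apply: (@small 70 (x * c ^+ 18)) => //; first by rewrite mulr_ge0 ?exprn_ge0.
  rewrite mulrC; apply: ler_pM => //; [exact: exprn_ge0|].
  by rewrite ler_weXn2l.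
have [hkG|hkG] := leqP (k ^ 2) #|G|.
  rewrite (minn_idPl hkG) in h; constructor 1; apply: (fin 1) => //.
  by apply: kK => //; rewrite mul1r hmin.
rewrite (minn_idPr (ltnW hkG)) in h; have hg := hmin _ h.
have [GT|GT] := eqVneq G setT.
  constructor 3; apply: Xe; rewrite -cardsT -GT; apply: le_trans hg _.
  have -> : c ^+ 16 * N * e ^+ 66 = c * (c ^+ 15 * e ^+ 66 * N) by ring.
  have -> : 2 * c ^+ 15 * e ^+ 66 * N = 2 * (c ^+ 15 * e ^+ 66 * N) by ring.
  by rewrite ler_wpM2r // !mulr_ge0 ?exprn_ge0 // ltW.
have Gp : proper_subfield G by split=> //; rewrite properT.
have kA : (k <= #|A :&: affine_image a' b' G|)%N.
  by rewrite /k -cB subset_leq_card // subsetI BA BG.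
case: (hG G a' b' Gp) => hAG.
  constructor 1; apply: (fin (K ^+ 2)) => //; apply: kK => //.
  apply: le_trans (_ : K ^+ 2 * #|G|%:R <= _); last by rewrite ler_wpM2l ?exprn_ge0.
  apply: le_trans hAG; rewrite natrX ler_pXn2r ?nnegrE // ler_nat //.
constructor 2; apply: le_trans cZ _.
apply: ler_pM => //; last by apply: le_trans hAG; rewrite ler_nat.
by apply: le_trans (lec 7%N isT); rewrite le_eqVlt; apply/orP; left; apply/eqP; ring.
Qed.

End EnergyBound.

(** * Counting collinear triples by ratio *)

Section CollinearTriples.
Variables (F : finFieldType) (A : {set F}).
Implicit Types (xi : F).

Local Ltac degenerate_card H HT D f :=
  rewrite -H; apply: (@card_injectS _ _ f);
  [ move=> [[[[[a1 a2] a3] b1] b2] b3] [[[[[a1' a2'] a3'] b1'] b2'] b3'];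
    rewrite ![_ \in D]inE => /andP[_ /andP[/eqP -> /eqP ->]]
      /andP[_ /andP[/eqP -> /eqP ->]];
    by case=> -> -> -> ->
  | move=> [[[[[a1 a2] a3] b1] b2] b3]; rewrite inE
      => /andP[/HT[[h1 h2 h3] [h4 h5 h6] _] _];
    by rewrite !in_setX; apply/andP; split; apply/andP ].

(** A nondegenerate collinear triple is a pair of edges of the same ratio
    [xi = (a3 - a1) / (a2 - a1) = (b3 - b1) / (b2 - b1)], one for each
    coordinate; the remaining solutions satisfy two linear equations. *)
Lemma collinear_count_le :
  (collinear_count A <=
   \sum_(xi in [set xi : F | (xi != 0%R) && (xi != 1%R)]) #|ratio_edges A xi| ^ 2
     + 5 * #|A| ^ 4)%N.
Proof.
rewrite /collinear_count; set T := [set t | _].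
pose A4 := setX (setX A A) (setX A A).
have cA4 : #|A4| = (#|A| ^ 4)%N by rewrite !cardsX; ring.
have TP a1 a2 a3 b1 b2 b3 : (a1, a2, a3, b1, b2, b3) \in T ->
    [/\ [/\ a1 \in A, a2 \in A & a3 \in A], [/\ b1 \in A, b2 \in A & b3 \in A]
      & (a2 - a1) * (b3 - b1) = (a3 - a1) * (b2 - b1)].
  by rewrite inE => /and3P[/and3P[-> -> ->] /and3P[-> -> ->] /eqP].
pose D1 := [set t in T | let: (a1, a2, a3, b1, b2, b3) := t in (a3 == a1) && (b3 == b1)].
pose D2 := [set t in T | let: (a1, a2, a3, b1, b2, b3) := t in (a3 == a2) && (b3 == b2)].
pose D3 := [set t in T | let: (a1, a2, a3, b1, b2, b3) := t in (a2 == a1) && (a3 == a1)].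
pose D4 := [set t in T | let: (a1, a2, a3, b1, b2, b3) := t in (a2 == a1) && (b2 == b1)].
pose D5 := [set t in T | let: (a1, a2, a3, b1, b2, b3) := t in (b2 == b1) && (b3 == b1)].
have c1 : (#|D1| <= #|A| ^ 4)%N.
  degenerate_card cA4 TP D1 (fun t : F * F * F * F * F * F =>
    let: (a1, a2, a3, b1, b2, b3) := t in ((a1, a2), (b1, b2))).
have c2 : (#|D2| <= #|A| ^ 4)%N.
  degenerate_card cA4 TP D2 (fun t : F * F * F * F * F * F =>
    let: (a1, a2, a3, b1, b2, b3) := t in ((a1, a2), (b1, b2))).
have c3 : (#|D3| <= #|A| ^ 4)%N.
  degenerate_card cA4 TP D3 (fun t : F * F * F * F * F * F =>
    let: (a1, a2, a3, b1, b2, b3) := t in ((a1, b1), (b2, b3))).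
have c4 : (#|D4| <= #|A| ^ 4)%N.
  degenerate_card cA4 TP D4 (fun t : F * F * F * F * F * F =>
    let: (a1, a2, a3, b1, b2, b3) := t in ((a1, a3), (b1, b3))).
have c5 : (#|D5| <= #|A| ^ 4)%N.
  degenerate_card cA4 TP D5 (fun t : F * F * F * F * F * F =>
    let: (a1, a2, a3, b1, b2, b3) := t in ((a1, a2), (a3, b1))).
pose D := D1 :|: D2 :|: D3 :|: D4 :|: D5.
have cD : (#|D| <= 5 * #|A| ^ 4)%N.
  have -> : (5 * #|A| ^ 4 = #|A| ^ 4 + #|A| ^ 4 + #|A| ^ 4 + #|A| ^ 4 + #|A| ^ 4)%N by ring.
  do 4!(apply: leq_trans (leq_card_setU _ _) _; apply: leq_add => //).
pose Xi := [set xi : F | (xi != 0) && (xi != 1)].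
pose W := [set k : F * ((F * F) * (F * F)) | [&& k.1 \in Xi,
   k.2.1 \in ratio_edges A k.1 & k.2.2 \in ratio_edges A k.1]].
have cW : #|W| = (\sum_(xi in Xi) #|ratio_edges A xi| ^ 2)%N.
  rewrite -sum1_card (eq_bigr (fun xi =>
    \sum_(pp in setX (ratio_edges A xi) (ratio_edges A xi)) 1)%N); last first.
    by move=> xi _; rewrite sum1_card cardsX expnS expn1.
  by rewrite pair_big_dep /=; apply: eq_bigl => k; rewrite !inE.
rewrite -(cardsID D T) addnC; apply: leq_add; last first.
  by apply: leq_trans cD; apply/subset_leq_card/subsetIr.
rewrite -cW.
have key a1 a2 a3 b1 b2 b3 : (a1, a2, a3, b1, b2, b3) \in T :\: D ->
    let xi := (a3 - a1) / (a2 - a1) in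
    [/\ xi \in Xi, [&& a1 \in A, a2 \in A & a3 \in A], [&& b1 \in A, b2 \in A & b3 \in A],
      apex xi a3 a2 = a1 /\ apex xi b3 b2 = b1 & a3 != a2 /\ b3 != b2].
  move=> /setDP[hT hD] xi; have [hA hB e] := TP _ _ _ _ _ _ hT.
  have [n1 n2 n3 n4 n5] : [/\ ~~ ((a3 == a1) && (b3 == b1)), ~~ ((a3 == a2) && (b3 == b2)),
      ~~ ((a2 == a1) && (a3 == a1)), ~~ ((a2 == a1) && (b2 == b1)) & ~~ ((b2 == b1) && (b3 == b1))].
    by move: hD; rewrite 4!in_setU !negb_or => /andP[/andP[/andP[/andP[]]]];
      rewrite [_ \in D1]inE [_ \in D2]inE [_ \in D3]inE [_ \in D4]inE [_ \in D5]inE hT.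
  have ea : a2 != a1.
    apply/negP => /eqP ea; move: n3 n4 e; rewrite ea eqxx subrr mul0r /= => h3 h4 /esym/eqP.
    by rewrite mulf_eq0 !subr_eq0 (negPf h3) (negPf h4).
  have ea' : a2 - a1 != 0 by rewrite subr_eq0.
  have eb : b3 - b1 = xi * (b2 - b1).
    by apply: (mulfI ea'); rewrite e /xi; field.
  have ea3 : a3 - a1 = xi * (a2 - a1) by rewrite /xi divfK.
  have nb : b2 != b1.
    apply/negP => /eqP nb; move: n5; rewrite nb eqxx /= -subr_eq0 eb nb subrr mulr0.
    by rewrite eqxx.
  have xi0 : xi != 0.
    apply/negP => /eqP x0; move: n1; rewrite -(subr_eq0 a3) -(subr_eq0 b3) ea3 eb x0 !mul0r.
    by rewrite eqxx.
  have xi1 : xi != 1.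
    apply/negP => /eqP x1; move: n2 ea3 eb; rewrite x1 !mul1r => h2 /addIr h3 /addIr h4.
    by move: h2; rewrite h3 h4 !eqxx.
  have x1' : 1 - xi != 0 by rewrite subr_eq0 eq_sym.
  split.
  - by rewrite inE xi0.
  - exact/and3P.
  - exact/and3P.
  - split; apply: (mulIf x1'); rewrite /apex divfK //.
      by rewrite -[a3](subrK a1) ea3; ring.
    by rewrite -[b3](subrK b1) eb; ring.
  - split; apply/negP => /eqP e3.
      case/negP: xi1; apply/eqP; apply: (mulIf ea'); by rewrite -ea3 mul1r e3.
    case/negP: xi1; apply/eqP; apply: (@mulIf _ (b2 - b1)); first by rewrite subr_eq0.
    by rewrite -eb mul1r e3.
apply: (@card_injectS _ _ (fun t => let: (a1, a2, a3, b1, b2, b3) := t in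
   ((a3 - a1) / (a2 - a1), ((a3, a2), (b3, b2))))).
  move=> [[[[[a1 a2] a3] b1] b2] b3] [[[[[a1' a2'] a3'] b1'] b2'] b3'].
  move=> /key[_ _ _ [h1 h2] _] /key[_ _ _ [h1' h2'] _] /= [e1 e2 e3 e4 e5].
  by rewrite -h1 -h2 -h1' -h2' e1 e2 e3 e4 e5.
move=> [[[[[a1 a2] a3] b1] b2] b3] /key.
set xi := _ / _ => -[h1 /and3P[ha1 ha2 ha3] /and3P[hb1 hb2 hb3] [e1 e2] [n1 n2]].
rewrite inE h1 /= !inE /= ha2 ha3 hb2 hb3 n1 n2 /=.
by rewrite e1 e2 ha1 hb1.
Qed.

End CollinearTriples.

(** * Lines and collinear triples *)

(** Hölder's inequality between the first three moments, from
    [S1 ^ 2 <= n S2] and [S2 ^ 2 <= S1 S3]; twice the gap in the latter is the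
    sum of [x i * x j * (x i - x j) ^ 2]. *)
Lemma power_moments (R : realFieldType) (I : finType) (X : {set I}) (x : I -> R) :
  (forall i, 0 <= x i) ->
  (\sum_(i in X) x i) ^+ 3 <= #|X|%:R ^+ 2 * \sum_(i in X) x i ^+ 3 /\
  (\sum_(i in X) x i ^+ 2) ^+ 3 <= #|X|%:R * (\sum_(i in X) x i ^+ 3) ^+ 2.
Proof.
move=> x0; set S1 := \sum_(i in X) x i; set S2 := \sum_(i in X) x i ^+ 2.
set S3 := \sum_(i in X) x i ^+ 3; set n := #|X|%:R.
have h1 : S1 ^+ 2 <= n * S2 by exact: sqr_sum_le.
have h2 : S2 ^+ 2 <= S1 * S3.
  have : 0 <= \sum_(i in X) \sum_(j in X) x i * x j * (x i - x j) ^+ 2.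
    apply: sumr_ge0 => i _; apply: sumr_ge0 => j _.
    by rewrite mulr_ge0 ?sqr_ge0 // mulr_ge0.
  have -> : \sum_(i in X) \sum_(j in X) x i * x j * (x i - x j) ^+ 2 =
      (S1 * S3 - S2 ^+ 2) *+ 2.
    have ei i : \sum_(j in X) x i * x j * (x i - x j) ^+ 2 =
        S1 * x i ^+ 3 + (- 2 * S2 * x i ^+ 2 + S3 * x i).
      rewrite (eq_bigr (fun j => x i ^+ 3 * x j + (- 2 * x i ^+ 2 * x j ^+ 2 + x i * x j ^+ 3))).
        by rewrite !big_split /= -!mulr_sumr -/S1 -/S2 -/S3; ring.
      by move=> j _; ring.
    rewrite (eq_bigr _ (fun i _ => ei i)) !big_split /= -!mulr_sumr -/S1 -/S2 -/S3.
    by ring.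
  by rewrite pmulrn_lge0 // subr_ge0.
have S10 : 0 <= S1 by apply: sumr_ge0.
have S20 : 0 <= S2 by apply: sumr_ge0 => i _; exact: sqr_ge0.
have S30 : 0 <= S3 by apply: sumr_ge0 => i _; exact: exprn_ge0.
have n0 : 0 <= n by exact: ler0n.
split.
  have [->|S1p] := eqVneq S1 0; first by rewrite expr0n mulr_ge0 ?exprn_ge0.
  have S1p' : 0 < S1 by rewrite lt0r S1p.
  rewrite -(ler_pM2l S1p') -exprS.
  apply: le_trans (_ : (n * S2) ^+ 2 <= _).
    by rewrite -[4%N]/(2 * 2)%N exprM lerXn2r // nnegrE ?sqr_ge0 ?mulr_ge0.
  by rewrite exprMn [leRHS]mulrCA ler_wpM2l ?exprn_ge0.
have [->|S2p] := eqVneq S2 0; first by rewrite expr0n mulr_ge0 ?exprn_ge0.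
have S2p' : 0 < S2 by rewrite lt0r S2p.
rewrite -(ler_pM2l S2p') -exprS.
apply: le_trans (_ : (S1 * S3) ^+ 2 <= _).
  by rewrite -[4%N]/(2 * 2)%N exprM lerXn2r // nnegrE ?sqr_ge0 ?mulr_ge0.
by rewrite exprMn [leRHS]mulrA (mulrC S2 n) ler_wpM2r ?exprn_ge0.
Qed.

Section Lines.
Variable F : finFieldType.
Implicit Types (p r : F * F) (l : {set F * F}) (P : {set F * F}) (L : {set {set F * F}}).

Definition line_through p p' : {set F * F} :=
  [set r | (p'.1 - p.1) * (r.2 - p.2) == (r.1 - p.1) * (p'.2 - p.2)].

Lemma line_through_memr p p' : p' \in line_through p p'.
Proof. by rewrite inE. Qed.

Lemma line_through_meml p p' : p \in line_through p p'.
Proof. by rewrite inE !subrr mulr0 mul0r. Qed.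

Lemma line_through_is_line p p' : p != p' -> is_line (line_through p p').
Proof.
move=> pp; apply/existsP; exists (p'.2 - p.2); apply/existsP; exists (p.1 - p'.1).
apply/existsP; exists ((p'.2 - p.2) * p.1 + (p.1 - p'.1) * p.2); apply/andP; split.
  apply: contra pp => /eqP[/eqP h1 /eqP h2]; move: h1 h2; rewrite !subr_eq0.
  by case: p => x y; case: p' => x' y' /= /eqP -> /eqP ->.
apply/eqP/setP => r; rewrite !inE.
rewrite -subr_eq0 -[RHS]subr_eq0 -[LHS]oppr_eq0; congr (_ == _); ring.
Qed.

Lemma line_throughE l p p' : is_line l -> p != p' -> p \in l -> p' \in l ->
  l = line_through p p'.
Proof.
move=> /existsP[u /existsP[v /existsP[w /andP[uv /eqP ->]]]] pp.
rewrite !inE => /eqP hp /eqP hp'; apply/setP => r; rewrite !inE.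
set d1 := p'.1 - p.1; set d2 := p'.2 - p.2; set x := r.1 - p.1; set y := r.2 - p.2.
have hd : u * d1 + v * d2 = 0.
  transitivity ((u * p'.1 + v * p'.2) - (u * p.1 + v * p.2)); first by rewrite /d1 /d2; ring.
  by rewrite hp hp' subrr.
have hx : (u * r.1 + v * r.2 == w) = (u * x + v * y == 0).
  by rewrite -subr_eq0 -{1}hp; congr (_ == _); rewrite /x /y; ring.
rewrite hx; apply/eqP/eqP => h.
  have hu : u * (d1 * y - x * d2) = 0.
    transitivity ((u * d1 + v * d2) * y - (u * x + v * y) * d2); first by ring.
    by rewrite hd h !mul0r subrr.
  have hv : v * (d1 * y - x * d2) = 0.
    transitivity ((u * x + v * y) * d1 - (u * d1 + v * d2) * x); first by ring.
    by rewrite hd h !mul0r subrr.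
  apply/eqP; rewrite -subr_eq0; apply: contraNT uv => n0.
  move/eqP: hu; rewrite mulf_eq0 (negPf n0) orbF => /eqP ->.
  by move/eqP: hv; rewrite mulf_eq0 (negPf n0) orbF => /eqP ->.
have h1 : d1 * (u * x + v * y) = 0.
  transitivity ((u * d1 + v * d2) * x + v * (d1 * y - x * d2)); first by ring.
  by rewrite hd h subrr mul0r mulr0 addr0.
have h2 : d2 * (u * x + v * y) = 0.
  transitivity ((u * d1 + v * d2) * y - u * (d1 * y - x * d2)); first by ring.
  by rewrite hd h subrr mul0r mulr0 subr0.
apply/eqP; apply: contraNT pp => n0.
move/eqP: h1; rewrite mulf_eq0 (negPf n0) orbF subr_eq0 => /eqP e1.
move/eqP: h2; rewrite mulf_eq0 (negPf n0) orbF subr_eq0 => /eqP e2.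
by rewrite -pair_eqE /pair_eq /= e1 e2 !eqxx.
Qed.

Definition distinct_pairs P : {set (F * F) * (F * F)} :=
  [set pp in setX P P | pp.1 != pp.2].

Lemma card_distinct_pairs P : (#|distinct_pairs P| + #|P| = #|P| ^ 2)%N.
Proof.
rewrite expnS expn1 -cardsX -(cardsID [set pp | pp.1 == pp.2] (setX P P)) addnC.
congr (_ + _)%N; last by apply: eq_card => pp; rewrite !inE andbC.
rewrite -(card_imset _ (fun p p' (e : (p, p) = (p', p')) => congr1 fst e)).
apply: eq_card => -[p p']; rewrite !inE /=; apply/imsetP/andP.
  by move=> [r hr [-> ->]]; rewrite hr.
by move=> [/andP[h1 h2] /eqP e]; exists p; rewrite // e.
Qed.

(** Two distinct points of [l] and a third one form a triple that determines
    [l]. *)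
Lemma sum_line_cubes (A : {set F}) L : (forall l, l \in L -> is_line l) ->
  (forall l, l \in L -> (1 < #|setX A A :&: l|)%N) ->
  (\sum_(l in L) #|setX A A :&: l| ^ 3 <= 2 * collinear_count A)%N.
Proof.
move=> hL hL2.
pose V l := setX (distinct_pairs (setX A A :&: l)) (setX A A :&: l).
apply: (@leq_trans (\sum_(l in L) 2 * #|V l|)%N).
  apply: leq_sum => l /hL2; rewrite /V cardsX.
  have := card_distinct_pairs (setX A A :&: l); set i := #|_ :&: _|; set j := #|_| => h i2.
  by rewrite expnSr mulnA leq_mul2r; apply/orP; right; nia.
rewrite -big_distrr /= leq_mul2l /=.
pose W := [set k : {set F * F} * (((F * F) * (F * F)) * (F * F)) |
  (k.1 \in L) && (k.2 \in V k.1)].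
have -> : (\sum_(l in L) #|V l| = #|W|)%N.
  rewrite -sum1_card (eq_bigr (fun l => \sum_(t in V l) 1)%N); last first.
    by move=> l _; rewrite sum1_card.
  by rewrite pair_big_dep /=; apply: eq_bigl => k; rewrite [RHS]inE.
have key l p p' r : (l, ((p, p'), r)) \in W ->
    [/\ p \in setX A A, p' \in setX A A, r \in setX A A, l = line_through p p' & r \in line_through p p'].
  rewrite inE /= => /andP[/hL hl]; rewrite in_setX => /andP[/=].
  rewrite inE => /andP[/setXP[/setIP[h1 h2] /setIP[h3 h4]] /= n] /setIP[h5 h6].
  by have e := line_throughE hl n h2 h4; split=> //; rewrite -e.
apply: (@card_injectS _ _ (fun k => (k.2.1.1.1, k.2.1.2.1, k.2.2.1,
                                     k.2.1.1.2, k.2.1.2.2, k.2.2.2))).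
  move=> [l [[[x1 y1] [x2 y2]] [x3 y3]]] [l' [[[x1' y1'] [x2' y2']] [x3' y3']]].
  move=> /key[_ _ _ -> _] /key[_ _ _ -> _] /= [-> -> -> -> -> ->].
  by [].
move=> [l [[[x1 y1] [x2 y2]] [x3 y3]]] /key.
rewrite !in_setX /= => -[/andP[h1 h2] /andP[h3 h4] /andP[h5 h6] _].
by rewrite !inE /= h1 h2 h3 h4 h5 h6.
Qed.

Lemma incidencesE P L : incidences P L = (\sum_(l in L) #|P :&: l|)%N.
Proof.
rewrite /incidences -sum1_card.
rewrite (eq_bigr (fun l => \sum_(p in P :&: l) 1)%N); last first.
  by move=> l _; rewrite sum1_card.
rewrite (exchange_big_dep (mem P)) /=; last by move=> l p _ /setIP[].
rewrite pair_big_dep /=; apply: eq_bigl => -[p l]; rewrite !inE /=.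
by case: (p \in P); case: (l \in L).
Qed.

Lemma sum_determined_lines P :
  (#|distinct_pairs P| <= \sum_(l in [set l : {set F * F} | is_line l &&
      [exists p in P, exists p' in P, [&& p != p', p \in l & p' \in l]]])
        #|P :&: l| ^ 2)%N.
Proof.
set D := [set l | _].
have hD pp : pp \in distinct_pairs P -> line_through pp.1 pp.2 \in D.
  case: pp => p p'; rewrite inE => /andP[/setXP[hp hp'] /= n]; rewrite inE line_through_is_line //=.
  apply/exists_inP; exists p => //; apply/exists_inP; exists p' => //.
  by rewrite n line_through_meml line_through_memr.
rewrite -sum1_card (partition_big (fun pp => line_through pp.1 pp.2) (mem D)) //=.
apply: leq_sum => l _; rewrite sum1_card expnS expn1 -cardsX; apply: subset_leq_card.
apply/subsetP => -[p p'] /andP[h /eqP <-]; move: h; rewrite inE => /andP[/setXP[hp hp'] _].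
by rewrite in_setX /= !in_setI hp hp' line_through_meml line_through_memr.
Qed.

Lemma determined_line_points P l : l \in [set l : {set F * F} | is_line l &&
      [exists p in P, exists p' in P, [&& p != p', p \in l & p' \in l]]] ->
  is_line l /\ (1 < #|P :&: l|)%N.
Proof.
rewrite inE => /andP[-> /exists_inP[p hp /exists_inP[p' hp' /and3P[n h h']]]].
split=> //; apply/card_gt1P; exists p, p'; split=> //; exact/setIP.
Qed.

End Lines.

(** * Real exponents and the three bounds *)

Section RealPowers.
Variable R : realType.
Implicit Types (x y a r : R).

Lemma le_root (n : nat) x y : (0 < n)%N -> 0 <= x -> 0 <= y ->
  x ^+ n <= y -> x <= y `^ n%:R^-1.
Proof.
move=> n0 x0 y0 h.
have -> : x = (x ^+ n) `^ n%:R^-1.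
  by rewrite -powR_mulrn // -powRrM mulfV ?powRr1 // pnatr_eq0 -lt0n.
by apply: ge0_ler_powR; rewrite ?invr_ge0 // nnegrE // exprn_ge0.
Qed.

Lemma le_powR_inv a (n : nat) : 1 <= a -> a `^ n%:R^-1 <= a.
Proof.
case: n => [|n] a1; first by rewrite invr0 powRr0.
by apply: ler1_powR => //; rewrite invf_le1 ?ltr0Sn // ler1n.
Qed.

Lemma powR_addr_le x y r : 0 <= x -> 0 <= y -> 0 <= r -> r <= 1 ->
  (x + y) `^ r <= 2 * (x `^ r + y `^ r).
Proof.
move=> x0 y0 r0 r1.
wlog xy : x y x0 y0 / x <= y.
  move=> h; have [/h|/ltW/h] := leP x y; first exact.
  by rewrite addrC [y `^ r + _]addrC; exact.
apply: le_trans (_ : (2 * y) `^ r <= _).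
  by apply: ge0_ler_powR => //; rewrite ?nnegrE ?addr_ge0 ?mulr_ge0 // mulr_natl mulr2n lerD2r.
rewrite powRM //; apply: ler_pM; rewrite ?powR_ge0 //.
  by apply: ler1_powR => //; rewrite ler1n.
by rewrite lerDr powR_ge0.
Qed.

(** Take [delta = T / (4 N ^ 5)].  When [T] exceeds [10 N ^ 4], the ratios
    [xi] with at least [delta N ^ 2] edges account for [delta N ^ 5] of the sum
    of the [Q xi ^ 2], and each alternative of [energy_dichotomy] bounds a power
    of [delta].  As [delta <= 1], the exponents 92 and 66 may be raised to the
    stated 104 and 95; the exponent 104 itself comes from
    [delta ^ 2 N <= C N ^ (51/52)]. *)
Lemma collinear_bound (K : R) : 0 < K ->
  exists2 C : R, 1 <= C & forall (F : finFieldType) (A : {set F}),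
    let q : R := #|F|%:R in
    let a : R := #|A|%:R in
    (0 < #|A|)%N ->
    (forall (G : {set F}) (c d : F), proper_subfield G ->
      #|A :&: affine_image c d G|%:R
        <= K * Num.max ((#|G|%:R : R) `^ (1 / 2)) (a `^ (51 / 52))) ->
    (collinear_count A)%:R
      <= C * (a `^ (5 - 1 / 104) + q `^ (- (1 / 95)) * a `^ (5 + 1 / 95)).
Proof.
move=> K0; pose K' := 1 + K; pose c : R := 2 ^+ 29.
have K'1 : 1 <= K' by rewrite lerDl ltW.
have K'0 : 0 <= K' := le_trans ler01 K'1.
have c1 : 1 <= c by rewrite exprn_ege1 // ler1n.
pose C1 := c ^+ 23 * K' ^+ 2.
have K'K : K' <= K' ^+ 2 by rewrite ler_eXnr.
have C1c (i : nat) : (i <= 23)%N -> c ^+ i <= C1.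
  move=> hi; rewrite -[leLHS]mulr1 ler_pM ?exprn_ge0 ?ler01 ?(le_trans ler01 c1) //.
    by rewrite ler_weXn2l.
  by rewrite exprn_ege1.
have C11 : 1 <= C1 by rewrite -(expr0 c) C1c.
have C10 : 0 <= C1 := le_trans ler01 C11.
exists (10 + 4 * C1) => [|F A q a A0 hK].
  by rewrite (le_trans _ (_ : 10 <= _)) ?ler1n // lerDl mulr_ge0.
have a1 : 1 <= a by rewrite /a ler1n.
have a0 : 0 < a := lt_le_trans ltr01 a1.
have a0' : 0 <= a := ltW a0.
have qa : a <= q by rewrite /a /q ler_nat -cardsT subset_leq_card // subsetT.
have q0 : 0 < q := lt_le_trans a0 qa.
have q0' : 0 <= q := ltW q0.
set X := a `^ (5 - _); set Y := _ * a `^ (5 + _).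
have X0 : 0 <= X by exact: powR_ge0.
have Y0 : 0 <= Y by rewrite mulr_ge0 ?powR_ge0.
set T : R := (collinear_count A)%:R.
have [hT|hT] := leP T (10 * a ^+ 4).
  apply: le_trans hT _; rewrite -powR_mulrn //.
  apply: ler_pM => //; rewrite ?powR_ge0 //; first by rewrite lerDl mulr_ge0.
  rewrite -[leLHS]addr0 lerD //; apply: ler_powR => //; lra.
have T0 : 0 < T by apply: lt_trans hT; rewrite mulr_gt0 // exprn_gt0.
pose delta := T / (4 * a ^+ 5).
have d0 : 0 < delta by rewrite divr_gt0 // mulr_gt0 // exprn_gt0.
have d0' : 0 <= delta := ltW d0.
have TE : T = 4 * delta * a ^+ 5 by rewrite /delta; field; rewrite gt_eqF.
pose Xi0 := [set xi : F | (xi != 0) && (xi != 1)].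
pose Q (xi : F) : R := #|ratio_edges A xi|%:R.
pose Xi := [set xi in Xi0 | delta * a ^+ 2 <= Q xi].
have Xi01 : 1 \notin Xi0 by rewrite inE eqxx andbF.
have XiXi0 : Xi \subset Xi0 by apply/subsetP => xi; rewrite inE => /andP[].
have Xi1 : 1 \notin Xi by apply: contra Xi01; exact: (subsetP XiXi0).
have Xi00 : 0 \notin Xi by rewrite !inE eqxx.
have sQ : \sum_(xi in Xi0) Q xi <= a ^+ 3.
  by rewrite -natr_sum -natrX ler_nat sum_ratio_edges.
have sQ2 : delta * a ^+ 5 <= \sum_(xi in Xi) Q xi ^+ 2.
  have : T <= \sum_(xi in Xi0) Q xi ^+ 2 + 5 * a ^+ 4.
    have := collinear_count_le A; rewrite -(ler_nat R) natrD natrM natr_sum natrX.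
    by under eq_bigr do rewrite natrX.
  rewrite (big_setID Xi) /= (setIidPr XiXi0).
  suff : \sum_(xi in Xi0 :\: Xi) Q xi ^+ 2 <= delta * a ^+ 5.
    set s1 := \sum_(_ in _) _; set s2 := \sum_(_ in _) _; rewrite TE in hT *; lra.
  apply: le_trans (_ : \sum_(xi in Xi0) (delta * a ^+ 2) * Q xi <= _).
    rewrite [leRHS](big_setID Xi) /= (setIidPr XiXi0) -[leLHS]add0r; apply: lerD.
      by apply: sumr_ge0 => xi _; rewrite mulr_ge0 // mulr_ge0 // exprn_ge0.
    apply: ler_sum => xi; rewrite !inE => /andP[+ hxi]; rewrite hxi /= -ltNge => /ltW h.
    by rewrite expr2 ler_wpM2r.
  rewrite -mulr_sumr; apply: le_trans (ler_wpM2l _ sQ) _.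
    by rewrite mulr_ge0 ?exprn_ge0 //.
  by rewrite le_eqVlt; apply/orP; left; apply/eqP; ring.
have d1 : delta <= 1.
  rewrite -(ler_pM2r (exprn_gt0 5 a0)) mul1r; apply: le_trans sQ2 _.
  apply: le_trans (_ : \sum_(xi in Xi) a ^+ 2 * Q xi <= _).
    apply: ler_sum => xi _; rewrite expr2 ler_wpM2r // /Q -natrX ler_nat.
    apply: leq_trans (subset_leq_card (ratio_edges_sub A xi)) _.
    by rewrite cardsX expnS expn1.
  rewrite -mulr_sumr [leRHS](_ : _ = a ^+ 2 * a ^+ 3); last by ring.
  rewrite ler_wpM2l ?exprn_ge0 //; apply: le_trans sQ.
  rewrite [leRHS](big_setID Xi) /= (setIidPr XiXi0) lerDl.
  by apply: sumr_ge0 => xi _.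
have hG (G : {set F}) (b d : F) : proper_subfield G ->
    #|A :&: affine_image b d G|%:R ^+ 2 <= K' ^+ 2 * #|G|%:R \/
    #|A :&: affine_image b d G|%:R <= K' * a `^ (51 / 52).
  move=> /hK-/(_ b d); set g : R := #|G|%:R; set n : R := _%:R => h.
  have KK' : K <= K' by rewrite lerDr.
  have [le|le] := leP (g `^ (1 / 2)) (a `^ (51 / 52)).
    right; apply: le_trans (h) _; rewrite max_r //.
    by rewrite ler_wpM2r ?powR_ge0.
  left; rewrite (max_l (ltW le)) in h.
  have -> : g = (g `^ (1 / 2)) ^+ 2 by rewrite mul1r powR12_sqrt // sqr_sqrtr.
  rewrite -exprMn lerXn2r ?nnegrE ?mulr_ge0 ?powR_ge0 //.
  by apply: le_trans h _; rewrite ler_wpM2r ?powR_ge0.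
have d01 : 0 < delta <= 1 by rewrite d0 d1.
have hQ xi : xi \in Xi -> delta * a ^+ 2 <= Q xi by rewrite inE => /andP[].
have fin (x : R) : delta <= C1 * x -> a ^+ 5 * x <= X + Y ->
    T <= (10 + 4 * C1) * (X + Y).
  move=> h1 h2; rewrite TE -mulrA mulrC -mulrA.
  apply: le_trans (_ : 4 * C1 * (X + Y) <= _); last first.
    by rewrite ler_wpM2r ?addr_ge0 // lerDr.
  apply: le_trans (_ : 4 * C1 * (a ^+ 5 * x) <= _); last first.
    by rewrite ler_wpM2l // mulr_ge0.
  have -> : 4 * C1 * (a ^+ 5 * x) = C1 * x * (a ^+ 5 * 4) by ring.
  by rewrite ler_wpM2r // mulr_ge0 ?exprn_ge0 //.
have X_le : a ^+ 5 * a `^ (- (1 / 104)) <= X + Y.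
  rewrite -powR_mulrn // -powRD; first by rewrite -/X lerDl.
  by rewrite (gt_eqF a0) implybT.
have root_a (x y : R) (n : nat) : (0 < n)%N -> 1 <= x -> 0 <= y -> x <= C1 ->
    delta ^+ n <= x * y -> delta <= C1 * y `^ n%:R^-1.
  move=> n0 x1 y0 xC h; have x0 := le_trans ler01 x1.
  apply: le_trans (le_root n0 (ltW d0) _ h) _; first exact: mulr_ge0.
  rewrite powRM // ler_wpM2r ?powR_ge0 // (le_trans _ xC) //.
  exact: le_powR_inv.
have ad (n m : nat) : (n <= m)%N -> delta ^+ m <= delta ^+ n.
  by move=> nm; apply: ler_wiXn2l => //; exact: ltW.
case: (energy_dichotomy a0 K'1 d01 Xi00 Xi1 hQ sQ2 hG) => h.
- apply: (fin (a `^ (- (1 / 104)))) => //.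
  have -> : - (1 / 104) = -1 * 104%:R^-1 :> R by field.
  rewrite powRrM powR_inv1 //; apply: (root_a C1) => //.
    by rewrite invr_ge0.
  rewrite ler_pdivlMr // (le_trans _ h) // [leRHS]mulrC ler_wpM2r //.
  exact: ad.
- apply: (fin (a `^ (- (1 / 104)))) => //.
  have -> : - (1 / 104) = - (1 / 52) * 2%:R^-1 :> R by field.
  rewrite powRrM; apply: (root_a (c * K')) => //.
  + by rewrite -[leLHS]mulr1 ler_pM.
  + by rewrite powR_ge0.
  + rewrite ler_pM ?(le_trans ler01 c1) //.
    by rewrite -[leLHS]expr1 ler_weXn2l.
  + have e : a `^ (- (1 / 52)) * a = a `^ (51 / 52).
      rewrite -[X in _ * X](powRr1 a0') -powRD; last by rewrite (gt_eqF a0) implybT.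
      by congr (_ `^ _); field.
    by rewrite -(ler_pM2r a0) -[leRHS]mulrA e -[leRHS]mulrA.
- apply: (fin ((a / q) `^ 95%:R^-1)).
    apply: (root_a (c ^+ 16)) => //; [exact: exprn_ege1|by rewrite divr_ge0|exact: C1c|].
    rewrite mulrA ler_pdivlMr // (le_trans _ h) // [leRHS]mulrC ler_wpM2r //.
    exact: ad.
  have e : (a / q) `^ 95%:R^-1 = q `^ (- (1 / 95)) * a `^ (1 / 95).
    rewrite powRM ?invr_ge0 // mulrC -powR_inv1 // -powRrM.
    by rewrite mulN1r div1r.
  rewrite e mulrCA -powR_mulrn // -powRD; last by rewrite (gt_eqF a0) implybT.
  by rewrite -/Y lerDr.
Qed.

End RealPowers.

Section FromCollinearTriples.
Variables (R : realType) (F : finFieldType) (A : {set F}) (C X Y : R).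
Hypothesis A0 : (1 < #|A|)%N.
Hypothesis C1 : 1 <= C.
Hypotheses (X0 : 0 < X) (Y0 : 0 < Y).
Hypothesis hT : (collinear_count A)%:R <= C * (X + Y).

Let P := setX A A.
Let a : R := #|A|%:R.

(** Lines with at most one point of [P] account for the term [#|L|]; on the
    others the cubes of the numbers of points sum to at most twice the number
    of collinear triples. *)
Lemma incidence_bound (L : {set {set F * F}}) :
  (forall l, l \in L -> is_line l) ->
  (incidences P L)%:R <= 4 * C * ((X `^ 3^-1 + Y `^ 3^-1) * #|L|%:R `^ (2 / 3) + #|L|%:R).
Proof.
move=> hL; pose x l : R := #|P :&: l|%:R.
pose L2 := [set l in L | (1 < #|P :&: l|)%N].
have L2L : L2 \subset L by apply/subsetP => l; rewrite inE => /andP[].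
have cubes : \sum_(l in L2) x l ^+ 3 <= 2 * (C * (X + Y)).
  apply: le_trans (_ : 2 * (collinear_count A)%:R <= _); last by rewrite ler_wpM2l.
  have : (\sum_(l in L2) #|P :&: l| ^ 3 <= 2 * collinear_count A)%N.
    by apply: sum_line_cubes => l; rewrite inE => /andP[/hL].
  rewrite -(ler_nat R) natrM natr_sum; apply: le_trans.
  by apply: ler_sum => l _; rewrite natrX.
have C0 : 0 <= C := le_trans ler01 C1.
have XY0 : 0 <= X + Y by rewrite addr_ge0 // ltW.
have rich : \sum_(l in L2) x l <= 4 * C * ((X `^ 3^-1 + Y `^ 3^-1) * #|L|%:R `^ (2 / 3)).
  have [h _] := power_moments L2 (fun l => ler0n R #|P :&: l|).
  have h' : (\sum_(l in L2) x l) ^+ 3 <= 2 * C * (X + Y) * #|L|%:R ^+ 2.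
    apply: le_trans h _; rewrite mulrC -[2 * C * _]mulrA; apply: ler_pM => //.
    - by apply: sumr_ge0 => l _; rewrite exprn_ge0.
    - by rewrite exprn_ge0.
    - by rewrite lerXn2r ?nnegrE // ler_nat subset_leq_card.
  apply: le_trans (@le_root R 3 _ _ isT _ _ h') _.
  - by apply: sumr_ge0 => l _; exact: ler0n.
  - by rewrite !mulr_ge0 ?exprn_ge0.
  have -> : (2 * C * (X + Y) * #|L|%:R ^+ 2) `^ 3^-1 =
      (2 * C) `^ 3^-1 * ((X + Y) `^ 3^-1 * #|L|%:R `^ (2 / 3)).
    rewrite powRM ?mulr_ge0 ?exprn_ge0 // powRM ?mulr_ge0 // -mulrA.
    by rewrite -[_ ^+ 2]powR_mulrn // -powRrM.
  have -> : 4 * C * ((X `^ 3^-1 + Y `^ 3^-1) * #|L|%:R `^ (2 / 3)) =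
     (2 * C) * ((2 * (X `^ 3^-1 + Y `^ 3^-1)) * #|L|%:R `^ (2 / 3)) by ring.
  apply: ler_pM; rewrite ?powR_ge0 ?mulr_ge0 ?powR_ge0 //.
    by apply: le_powR_inv; rewrite (le_trans C1) // ler_peMl // ler1n.
  apply: ler_wpM2r; first exact: powR_ge0.
  apply: powR_addr_le; [exact: ltW|exact: ltW|by rewrite invr_ge0|].
  by rewrite invf_le1 // ler1n.
rewrite incidencesE natr_sum (big_setID L2) /= (setIidPr L2L) mulrDr; apply: lerD => //.
apply: le_trans (_ : \sum_(l in L) 1 <= _).
  rewrite [leRHS](big_setID L2) /= (setIidPr L2L) -[leLHS]add0r; apply: lerD.
    by apply: sumr_ge0.
  apply: ler_sum => l; rewrite !inE => /andP[+ hl]; rewrite hl /= -leqNgt => h.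
  by rewrite -[1]/(1%:R) ler_nat.
by rewrite sumr_const ler_peMl //; have := C1; lra.
Qed.

(** Every pair of distinct points lies on a determined line, so the squares of
    the numbers of points sum to at least [a ^ 4 / 2]. *)
Lemma determined_lines_bound :
  a ^+ 12 <= 128 * C ^+ 2 * Num.max X Y ^+ 2 * (determined_lines P)%:R.
Proof.
rewrite /determined_lines; set D := [set l | _].
pose x l : R := #|P :&: l|%:R.
have C0 : 0 <= C := le_trans ler01 C1.
have hD l : l \in D -> is_line l /\ (1 < #|P :&: l|)%N by exact: determined_line_points.
have cubes : \sum_(l in D) x l ^+ 3 <= 2 * (C * (X + Y)).
  apply: le_trans (_ : 2 * (collinear_count A)%:R <= _); last by rewrite ler_wpM2l.
  have : (\sum_(l in D) #|P :&: l| ^ 3 <= 2 * collinear_count A)%N.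
    by apply: sum_line_cubes => l /hD[].
  rewrite -(ler_nat R) natrM natr_sum; apply: le_trans.
  by apply: ler_sum => l _; rewrite natrX.
have squares : a ^+ 4 / 2 <= \sum_(l in D) x l ^+ 2.
  have h1 := sum_determined_lines P; rewrite -/D in h1.
  have h2 := card_distinct_pairs P.
  have h3 : (#|A| ^ 4 <= 2 * #|distinct_pairs P|)%N.
    move: h2; rewrite /P cardsX; set n := #|_|; set m := #|A|.
    have : (2 <= m)%N by []. nia.
  have h4 : #|distinct_pairs P|%:R <= \sum_(l in D) x l ^+ 2.
    move: h1; rewrite -(ler_nat R) natr_sum => /le_trans; apply.
    by apply: ler_sum => l _; rewrite natrX.
  move: h3; rewrite -(ler_nat R) natrM natrX -/a => h3.
  by rewrite ler_pdivrMr // (le_trans h3) // mulrC ler_wpM2r.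
have [_ h] := power_moments D (fun l => ler0n R #|P :&: l|).
set m := Num.max X Y; have m0 : 0 <= m by rewrite le_max ltW.
have XYm : X + Y <= 2 * m.
  by rewrite mulr_natl mulr2n lerD // le_max lexx ?orbT.
have h1 : (a ^+ 4 / 2) ^+ 3 <= (\sum_(l in D) x l ^+ 2) ^+ 3.
  by rewrite lerXn2r // nnegrE ?divr_ge0 ?exprn_ge0 //; apply: sumr_ge0 => l _; exact: sqr_ge0.
have h2 : (\sum_(l in D) x l ^+ 3) ^+ 2 <= (4 * C * m) ^+ 2.
  rewrite lerXn2r // ?nnegrE.
  - by apply: sumr_ge0 => l _; rewrite exprn_ge0.
  - by rewrite !mulr_ge0.
  - apply: le_trans cubes _; have -> : 4 * C * m = 2 * (C * (2 * m)) by ring.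
    by rewrite ler_wpM2l // ler_wpM2l.
have h3 := le_trans h1 (le_trans h (ler_wpM2l (ler0n R #|D|) h2)).
have -> : a ^+ 12 = 8 * (a ^+ 4 / 2) ^+ 3 by field.
have -> : 128 * C ^+ 2 * m ^+ 2 * #|D|%:R = 8 * (#|D|%:R * (4 * C * m) ^+ 2) by ring.
by rewrite ler_wpM2l.
Qed.

End FromCollinearTriples.

Theorem theorem2 (R : realType) (K : R) (hK : 0 < K) :
  exists2 C : R, 0 < C &
    forall (F : finFieldType) (A : {set F}) (L : {set {set F * F}}),
    let q : R := #|F|%:R in
    let a : R := #|A|%:R in
    0 \notin A ->
    (2 <= #|A|)%N ->
    (forall l : {set F * F}, l \in L -> is_line l) ->
    (forall (G : {set F}) (c d : F), proper_subfield G ->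
      #|A :&: affine_image c d G|%:R
        <= K * Num.max ((#|G|%:R : R) `^ (1 / 2)) (a `^ (51 / 52))) ->
    [/\ (collinear_count A)%:R
          <= C * (a `^ (5 - 1 / 104) + q `^ (- (1 / 95)) * a `^ (5 + 1 / 95)),
        (incidences (setX A A) L)%:R
          <= C * ((a `^ (173 / 104) + q `^ (- (1 / 285)) * a `^ (476 / 285))
                    * (#|L|%:R : R) `^ (2 / 3) + #|L|%:R)
      & Num.min (a `^ (2 + 1 / 52)) (q `^ (2 / 95) * a `^ (2 - 2 / 95))
          <= C * (determined_lines (setX A A))%:R].
Proof.
have [C C1 hC] := collinear_bound hK.
have C0 : 0 <= C := le_trans ler01 C1.
have C2 : C <= C ^+ 2 by rewrite ler_eXnr.
have C20 : 0 <= C ^+ 2 by rewrite exprn_ge0.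
exists (128 * C ^+ 2) => [|F A L q a _ A2 hL hA].
  by rewrite mulr_gt0 // exprn_gt0 // (lt_le_trans ltr01 C1).
have a1 : 1 <= a by rewrite /a ler1n ltnW.
have a0 : 0 < a := lt_le_trans ltr01 a1.
have q0 : 0 < q.
  by rewrite /q ltr0n -cardsT; apply: leq_trans (ltnW A2) _; rewrite subset_leq_card // subsetT.
have hT := hC F A (ltnW A2) hA; rewrite /= -/q -/a in hT.
set X := a `^ (5 - 1 / 104) in hT *; set Y := q `^ (- (1 / 95)) * a `^ (5 + 1 / 95) in hT *.
have X0 : 0 < X by exact: powR_gt0.
have Y0 : 0 < Y by rewrite mulr_gt0 ?powR_gt0.
have XY0 : 0 <= X + Y by rewrite addr_ge0 // ltW.
split.
- by apply: le_trans hT _; rewrite ler_wpM2r //; lra.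
- apply: le_trans (incidence_bound C1 X0 Y0 hT hL) _.
  have -> : X `^ 3^-1 = a `^ (173 / 104).
    by rewrite /X -powRrM; congr (_ `^ _); field.
  have -> : Y `^ 3^-1 = q `^ (- (1 / 285)) * a `^ (476 / 285).
    rewrite /Y powRM ?powR_ge0 // -!powRrM.
    by congr (_ `^ _ * _ `^ _); field.
  apply: ler_wpM2r; last by lra.
  by rewrite addr_ge0 // mulr_ge0 ?addr_ge0 ?mulr_ge0 ?powR_ge0.
have hD := determined_lines_bound A2 C1 X0 Y0 hT; rewrite -/a in hD.
set D := (determined_lines _)%:R in hD *.
have [XY|XY] := leP X Y.
  rewrite (max_r XY) in hD; apply: le_trans (_ : q `^ (2 / 95) * a `^ (2 - 2 / 95) <= _).
    by rewrite ge_min lexx orbT.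
  rewrite -(ler_pM2r (exprn_gt0 2 Y0)) [leRHS]mulrAC; apply: le_trans hD.
  have -> : Y ^+ 2 = q `^ (- (2 / 95)) * a `^ (10 + 2 / 95).
    rewrite /Y exprMn -!powR_mulrn ?powR_ge0 // -!powRrM.
    by congr (_ `^ _ * _ `^ _); field.
  rewrite mulrACA -!powRD ?(gt_eqF a0) ?(gt_eqF q0) ?implybT //.
  have -> : 2 / 95 - 2 / 95 = 0 :> R by rewrite subrr.
  rewrite powRr0 mul1r -(powR_mulrn _ (ltW a0)).
  by rewrite le_eqVlt; apply/orP; left; apply/eqP; congr (_ `^ _); field.
rewrite (max_l (ltW XY)) in hD; apply: le_trans (_ : a `^ (2 + 1 / 52) <= _).
  by rewrite ge_min lexx.
rewrite -(ler_pM2r (exprn_gt0 2 X0)) [leRHS]mulrAC; apply: le_trans hD.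
have -> : X ^+ 2 = a `^ (10 - 1 / 52).
  by rewrite /X -powR_mulrn ?powR_ge0 // -powRrM; congr (_ `^ _); field.
rewrite -powRD ?(gt_eqF a0) ?implybT // -[leRHS]powR_mulrn; last exact: ltW.
by rewrite le_eqVlt; apply/orP; left; apply/eqP; congr (_ `^ _); field.
Qed.
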